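(* (a) If $X$ and $P$ are finite, then the word problem for $M(X,P)$ is decidable. (b) If $X$ and $P$ are finite and $H$ is a finitely generated closed inverse submonoid of $M(X,P)$ (i.e. $H=N^\omega$ for the inverse submonoid $N$ generated by a finite subset of $M(X,P)$), then the associated $\Delta$-complex $\mathcal C_H$ (the unique connected $\Delta$-complex labeled over $B(X,P)$, with a $0$-cell $v$ such that $L(\mathcal C_H,v)=H$) is finite, and it can be effectively constructed from a finite generating set of $H$.
   Context: A $\Delta$-complex is a CW-complex in which each $k$-cell $c$ has a distinguished characteristic map $\sigma_c\colon\Delta^k=[v_0,\dots,v_k]\to\mathcal C$ whose restriction to each $(k-1)$-face (identified order-preservingly with $\Delta^{k-1}$) is the distinguished characteristic map of a $(k-1)$-cell; the root of $c$ is $\sigma_c(v_0)$; a $1$-cell $e$ goes from $\sigma_e(v_0)$ to $\sigma_e(v_1)$. An immersion is a continuous map that is a local homeomorphism onto its image and commutes with characteristic maps (each $k$-cell $d$ maps onto a $k$-cell with $f\circ\sigma_d=\sigma_{f(d)}$). $B(X,P)$ is a finite-dimensional $\Delta$-complex with one $0$-cell, $1$-cells indexed by $X$, $k$-cells ($2\le k\le n$) indexed by $P_k$, index sets pairwise disjoint, $P=\bigcup P_k$. A complex is labeled over $B(X,P)$ via an immersion to $B(X,P)$, and $\ell(c)$ is the index of the image cell. Boundary labels: for a $k$-cell $c$ ($k\ge2$) with characteristic map $\sigma$, $c_i$ is the $(k-1)$-cell with characteristic map $\sigma$ restricted to the face omitting $v_i$, $e(c)=\sigma([v_0,v_1])$;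 $bl(c)=\ell(\sigma[v_0,v_1])\ell(\sigma[v_1,v_2])\ell(\sigma[v_0,v_2])^{-1}$ if $k=2$, $bl(c)=\ell(c_k)\cdots\ell(c_1)\ell(e(c))\ell(c_0)\ell(e(c))^{-1}$ if $k\ge3$; $bl(\rho)$ is that of the cell of $B(X,P)$ labeled $\rho$. $M(X,P)$ is the inverse monoid presented by generators $X\cup P$ and relations $\rho^2=\rho$, $\rho=\rho\,bl(\rho)$ for $\rho\in P$ (the word problem asks to decide whether two words over $X\cup X^{-1}\cup P$ represent the same element). $M(X,P)$ acts on the right by partial injections on the $0$-cells of a labeled complex: $v\cdot x=w$ iff there is a $1$-cell labeled $x\in X$ from $v$ to $w$, $v\cdot x^{-1}=w$ iff there is one from $w$ to $v$, $v\cdot\rho=v$ iff $v$ is the root of a cell labeled $\rho\in P$; the loop monoid is $L(\mathcal C,v)=\{m: v\cdot m=v\}$. Natural partial order $a\le b$ iff $a=eb$ with $e$ idempotent; $N^\omega=\{m: m\ge n, n\in N\}$; closed means $N=N^\omega$. *)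

(* Defs.v *)
From mathcomp Require Import all_boot.
From Stdlib Require Import Relations.
From Stdlib Require List.
Set Implicit Arguments. Unset Strict Implicit. Unset Printing Implicit Defensive.

(* Delta-complexes, combinatorially: semi-simplicial sets.             *)
(* cell k = the k-cells; face k i : cell k.+1 -> cell k is the         *)
(* restriction of the characteristic map to the face omitting v_i.    *)
Definition is_ss (cell : nat -> Type) (face : forall k, nat -> cell k.+1 -> cell k)
  : Prop :=
  forall k i j (c : cell k.+2), i < j -> j <= k.+2 ->
    face k i (face k.+1 j c) = face k j.-1 (face k.+1 i c).

Fixpoint vert (cell : nat -> Type) (face : forall k, nat -> cell k.+1 -> cell k)
  (k i : nat) : cell k -> cell 0 :=
  match k as k0 return cell k0 -> cell 0 with
  | 0 => fun c => c
  | k'.+1 => fun c => if i < k'.+1 then @vert cell face k' i (face k' k'.+1 c)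
                      else @vert cell face k' k' (face k' 0 c)
  end.
Arguments vert {cell} face {k} i c.

(* the edge e(c) = sigma_c([v_0,v_1]) of a (k+1)-cell *)
Fixpoint edge (cell : nat -> Type) (face : forall k, nat -> cell k.+1 -> cell k)
  (k : nat) : cell k.+1 -> cell 1 :=
  match k as k0 return cell k0.+1 -> cell 1 with
  | 0 => fun c => c
  | k'.+1 => fun c => @edge cell face k' (face k'.+1 k'.+2 c)
  end.

Definition cellB (X P : Type) (dim : P -> nat) (k : nat) : Type :=
  match k with
  | 0 => unit
  | 1 => X
  | k'.+2 => {r : P | dim r = k'.+2}
  end.

Record Bdata (X P : Type) := {
  bdim : P -> nat;
  bdim_ge2 : forall r, 2 <= bdim r;
  bface : forall k, nat -> @cellB X P bdim k.+1 -> @cellB X P bdim k;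
  bface_ss : is_ss bface
}.

Inductive letter (X P : Type) := Lx of X | Lxi of X | Lp of P.
Arguments Lx {X P}. Arguments Lxi {X P}. Arguments Lp {X P}.
Definition word (X P : Type) := seq (letter X P).

Definition invl (X P : Type) (a : letter X P) : letter X P :=
  match a with Lx x => Lxi x | Lxi x => Lx x | Lp r => Lp r end.
Definition invw (X P : Type) (w : word X P) : word X P := rev (map (@invl X P) w).

Definition blk (X P : Type) (B : Bdata X P) (k : nat) :
  @cellB X P (bdim B) k.+2 -> word X P :=
  match k as k0 return @cellB X P (bdim B) k0.+2 -> word X P with
  | 0 => fun c => [:: Lx (@bface X P B 1 2 c); Lx (@bface X P B 1 0 c); Lxi (@bface X P B 1 1 c)]
  | m.+1 => fun c =>
      let e : X := @edge _ (@bface X P B) m.+2 c in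
      [seq Lp (proj1_sig (@bface X P B m.+2 (m.+3 - j) c : @cellB X P (bdim B) m.+2))
        | j <- iota 0 m.+3]
      ++ [:: Lx e; Lp (proj1_sig (@bface X P B m.+2 0 c : @cellB X P (bdim B) m.+2)); Lxi e]
  end.

(* The congruence presenting M(X,P) as an inverse monoid:
   Wagner congruence (inverse monoid axioms) + rho^2 = rho + rho = rho bl(rho). *)
Inductive Mcong (X P : Type) (B : Bdata X P) : word X P -> word X P -> Prop :=
| Mc_refl u : Mcong B u u
| Mc_sym u v : Mcong B u v -> Mcong B v u
| Mc_trans u v w : Mcong B u v -> Mcong B v w -> Mcong B u w
| Mc_ctx a b u v : Mcong B u v -> Mcong B (a ++ u ++ b) (a ++ v ++ b)
| Mc_inv1 w : Mcong B (w ++ invw w ++ w) w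
| Mc_inv2 w z : Mcong B (w ++ invw w ++ z ++ invw z) (z ++ invw z ++ w ++ invw w)
| Mc_idem r : Mcong B [:: Lp r; Lp r] [:: Lp r]
| Mc_bl k (c : @cellB X P (bdim B) k.+2) :
    Mcong B [:: Lp (proj1_sig (c : {r : P | bdim B r = k.+2}))]
            (Lp (proj1_sig (c : {r : P | bdim B r = k.+2})) :: @blk X P B k c).

Definition leM (X P : Type) (B : Bdata X P) (a b : word X P) : Prop :=
  exists e : word X P, Mcong B (e ++ e) e /\ Mcong B a (e ++ b).

Inductive genN (X P : Type) (gens : seq (word X P)) : word X P -> Prop :=
| gN_nil : genN gens [::]
| gN_cons g w : List.In g gens -> genN gens w -> genN gens (g ++ w)
| gN_consi g w : List.In g gens -> genN gens w -> genN gens (invw g ++ w).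

Definition inN (X P : Type) (B : Bdata X P) (gens : seq (word X P)) (w : word X P) :=
  exists u, genN gens u /\ Mcong B w u.

Definition inH (X P : Type) (B : Bdata X P) (gens : seq (word X P)) (w : word X P) :=
  exists n, inN B gens n /\ leM B n w.

Record LC (X P : Type) (B : Bdata X P) (cell : nat -> Type) := {
  lface : forall k, nat -> cell k.+1 -> cell k;
  lface_ss : is_ss lface;
  lab : forall k, cell k -> @cellB X P (bdim B) k;
  lab_face : forall k i (c : cell k.+1), i <= k.+1 ->
      lab (lface i c) = @bface X P B k i (lab c);
  (* local injectivity: the star of each 0-cell embeds *)
  lab_imm : forall k i (c c' : cell k), i <= k ->
      vert lface i c = vert lface i c' -> lab c = lab c' -> c = c'
}.
Arguments lface {X P B cell} _ k i c.
Arguments lab {X P B cell} _ {k} c.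

Section Complex.
Variables (X P : Type) (B : Bdata X P) (cell : nat -> Type) (C : LC B cell).

Definition adj (v w : cell 0) : Prop :=
  exists e : cell 1, lface C 0 1 e = v /\ lface C 0 0 e = w.

Definition connected : Prop := forall v w, clos_refl_sym_trans _ adj v w.

Definition step (v : cell 0) (a : letter X P) (w : cell 0) : Prop :=
  match a with
  | Lx x => exists e : cell 1, (lab C e : X) = x /\ lface C 0 1 e = v /\ lface C 0 0 e = w
  | Lxi x => exists e : cell 1, (lab C e : X) = x /\ lface C 0 1 e = w /\ lface C 0 0 e = v
  | Lp r => v = w /\ exists k (c : cell k.+2),
      proj1_sig (lab C c : {r : P | bdim B r = k.+2}) = r /\ vert (lface C) 0 c = v
  end.

Inductive act : cell 0 -> word X P -> cell 0 -> Prop :=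
| act_nil v : act v [::] v
| act_cons v a u w v' : step v a u -> act u w v' -> act v (a :: w) v'.

Definition loopw (v : cell 0) (w : word X P) : Prop := act v w v.

Definition finite_complex : Prop :=
  forall k, exists s : list (cell k), forall c, List.In c s.

End Complex.

(* Main.v *)
From HB Require Import structures.
Require Import Defs.
From mathcomp Require Import all_boot.
From Stdlib Require Import Relations Setoid Morphisms.
Set Implicit Arguments. Unset Strict Implicit. Unset Printing Implicit Defensive.

(* Stephen's procedure. Start from the vertices spelled by the prefixes of the generators of H,
   attach at each letter of P a full simplex, and identify vertices as local injectivity forces.
   Attaching a cell produces only cells of smaller dimension, so everything happens over a
   finite set of vertices given in advance, and the complex is a least fixed point over a finite
   set of facts. Each vertex carries a word, and each derived fact p -a-> q means that
   p a q^-1 lies in H; hence the words looping at the base vertex are exactly those of H.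

   A connected complex is determined by its loop monoid, because cells reached from the base
   vertex by a word u are detected by the loops u a u^-1; hence C_H is finite. For the word
   problem, u <= v iff v u^-1 belongs to the closed inverse submonoid generated by u u^-1. *)

(** * The inverse monoid M(X,P) and its closed inverse submonoids *)

(** A simplex needs vertices besides its root, and the boundary label of a letter of P contains
    further letters with boundaries of their own; this is what could make the expansion run away. It
    does not, because every other vertex of a simplex is joined to the root by an edge, a spoke, and
    the labels of the spokes are determined by the letter. Spokes are supplied once, with the
    letters read along the generators. A face through the root inherits them, and the spokes
    [v_1,v_i] of the face opposite the root are third sides of triangles [v_0,v_1,v_i].
    Identification of vertices is itself a fact, so nothing is ever replaced: derivation is
    monotone, and the quotient is formed only after saturation, by choosing representatives. The
    rules that involve cells are inequalities of M(X,P), hence sound for the upward closed H.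
    Conversely the saturated facts form a genuine labeled complex, whose loop monoids are
    automatically closed inverse submonoids. These two halves give equality with H. *)

Section InverseMonoid.
Variables (X P : Type) (B : Bdata X P).
Implicit Types (u v w z e f g n m : word X P) (gens : seq (word X P)).
Local Notation "u =~ v" := (Mcong B u v) (at level 70).

#[local] Hint Resolve Mc_refl : core.

#[local] Instance Mcong_equivalence : Equivalence (Mcong B).
Proof.
by split=> [u|u v|u v w]; [exact: Mc_refl | exact: Mc_sym | exact: Mc_trans].
Qed.

#[local] Instance cat_Mcong :
  Proper (Mcong B ==> Mcong B ==> Mcong B) (@cat (letter X P)).
Proof.
move=> u u' uu' v v' vv'; apply: (@Mc_trans _ _ _ _ (u' ++ v)).
  exact: (Mc_ctx [::] v uu').
by have := Mc_ctx u' [::] vv'; rewrite !cats0.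
Qed.

Lemma invlK : involutive (@invl X P).
Proof. by case. Qed.

Lemma invwK : involutive (@invw X P).
Proof. by move=> w; rewrite /invw map_rev revK mapK //; apply: invlK. Qed.

Lemma invw_cat u v : invw (u ++ v) = invw v ++ invw u.
Proof. by rewrite /invw map_cat rev_cat. Qed.

Definition midem e := e ++ e =~ e.

Lemma mulVK u v : u ++ invw u ++ u ++ v =~ u ++ v.
Proof.
have -> : u ++ invw u ++ u ++ v = (u ++ invw u ++ u) ++ v by rewrite -!catA.
by rewrite (Mc_inv1 B u).
Qed.

Lemma VmulK u v : invw u ++ u ++ invw u ++ v =~ invw u ++ v.
Proof. by have := mulVK (invw u) v; rewrite invwK. Qed.

Lemma rangeC u v w : u ++ invw u ++ v ++ invw v ++ w =~ v ++ invw v ++ u ++ invw u ++ w.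
Proof.
have := Mc_ctx [::] w (Mc_inv2 B u v).
by rewrite /= -!catA.
Qed.

Lemma midem_range u : midem (u ++ invw u).
Proof. by rewrite /midem -!catA mulVK. Qed.

Lemma midem_domain u : midem (invw u ++ u).
Proof. by have := midem_range (invw u); rewrite invwK. Qed.

Lemma midemK e w : midem e -> e ++ e ++ w =~ e ++ w.
Proof. by move=> ee; rewrite catA ee. Qed.

(** The axioms only commute idempotents of the form [w ++ invw w]. Commuting the domain and the
    range of [e] gives e^-1 = e e^-1 e^-1 e, so e^-1 absorbs [e] on both sides and e = e e^-1 e =
    e^-1. Thus every idempotent is a range, and all idempotents commute. *)
Lemma midem_inv e : midem e -> invw e =~ e.
Proof.
move=> ee.
have eV : invw e =~ e ++ invw e ++ invw e ++ e.
  have := rangeC (invw e) e [::]; rewrite invwK !cats0 => <-.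
  by rewrite (midemK _ ee) -{1}(cats0 (invw e)) -VmulK cats0.
have eV1 : invw e =~ e ++ invw e.
  by rewrite {2}eV (midemK _ ee) -eV.
have eV2 : invw e =~ invw e ++ e.
  by rewrite {2}eV -!catA ee -eV.
rewrite -{2}(Mc_inv1 B e) catA -eV1 -eV2.
by [].
Qed.

Lemma midem_range_eq e : midem e -> e ++ invw e =~ e.
Proof. by move=> ee; rewrite (midem_inv ee) ee. Qed.

Lemma midemC e f : midem e -> midem f -> e ++ f =~ f ++ e.
Proof.
move=> ee ff; rewrite -(midem_range_eq ee) -(midem_range_eq ff).
by have := Mc_inv2 B e f; rewrite -!catA.
Qed.

Lemma midemCk e f w : midem e -> midem f -> e ++ f ++ w =~ f ++ e ++ w.
Proof. by move=> ee ff; rewrite catA (midemC ee ff) -catA. Qed.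

Lemma midem_cat e f : midem e -> midem f -> midem (e ++ f).
Proof.
move=> ee ff; rewrite /midem -!catA (midemCk _ ff ee) (midemK _ ee).
by rewrite ff.
Qed.

Lemma midem_conj e u : midem e -> midem (u ++ e ++ invw u).
Proof.
move=> ee; rewrite /midem -!catA.
have := midemCk (invw u) (midem_domain u) ee; rewrite -!catA => ->.
rewrite (midemK _ ee).
by have := VmulK u [::]; rewrite !cats0 => ->.
Qed.

(** [Mcong] has no constructor for inverses. This is the uniqueness of inverses: [invw u] and
    [invw v] are both inverses of [u], and the idempotents they form with [u] commute. *)
Lemma invw_Mcong u v : u =~ v -> invw u =~ invw v.
Proof.
move=> uv.
have uyu : u ++ invw v ++ u =~ u by rewrite uv Mc_inv1.
have yuy : invw v ++ u ++ invw v =~ invw v.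
  by rewrite uv; have := Mc_inv1 B (invw v); rewrite invwK.
have iyu : midem (invw v ++ u) by rewrite /midem -!catA uyu.
have iuy : midem (u ++ invw v) by rewrite /midem -!catA yuy.
transitivity (invw v ++ u ++ invw u).
  have := midemCk (invw u) iyu (midem_domain u); rewrite -!catA.
  have E : invw u ++ u ++ invw u =~ invw u by have := Mc_inv1 B (invw u); rewrite invwK.
  rewrite E => ->.
  have -> : invw u ++ u ++ invw v ++ u ++ invw u =
            invw u ++ (u ++ invw v ++ u) ++ invw u by rewrite -!catA.
  by rewrite uyu E.
have := midemC iuy (midem_range u); rewrite -!catA.
have -> : u ++ invw v ++ u ++ invw u = (u ++ invw v ++ u) ++ invw u by rewrite -!catA.
rewrite uyu => ->.
have -> : invw v ++ u ++ invw u ++ u ++ invw v = invw v ++ (u ++ invw u ++ u) ++ invw v.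
  by rewrite -!catA.
by rewrite Mc_inv1 yuy.
Qed.

Lemma leM_eq u v : u =~ v -> leM B u v.
Proof. by move=> uv; exists [::]; split. Qed.

Lemma leM_refl u : leM B u u.
Proof. exact: leM_eq. Qed.

Lemma leM_trans v u w : leM B u v -> leM B v w -> leM B u w.
Proof.
move=> [e [ee ue]] [f [ff vf]]; exists (e ++ f); split; first exact: midem_cat.
by rewrite ue vf -catA.
Qed.

#[local] Instance leM_Mcong : Proper (Mcong B ==> Mcong B ==> iff) (leM B).
Proof.
move=> u u' uu' v v' vv'; split=> H.
  by apply: (leM_trans (leM_eq (Mc_sym uu'))); apply: leM_trans H (leM_eq vv').
by apply: (leM_trans (leM_eq uu')); apply: leM_trans H (leM_eq (Mc_sym vv')).
Qed.

Lemma leM_anti u v : leM B u v -> leM B v u -> u =~ v.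
Proof.
move=> [e [ee ue]] [f [ff vf]].
have uef : u =~ e ++ f ++ u by rewrite -vf.
by rewrite vf {2}uef (midemCk _ ff ee) (midemK _ ff) -uef.
Qed.

Lemma leM_cat u u' v v' : leM B u u' -> leM B v v' -> leM B (u ++ v) (u' ++ v').
Proof.
(* Since [f] commutes with the domain of u', u' f = (u' f u'^-1) u', so the conjugate carries [f] to
   the left of u'. *)
move=> [e [ee ue]] [f [ff vf]]; exists (e ++ u' ++ f ++ invw u'); split.
  by apply: midem_cat => //; apply: midem_conj.
rewrite ue vf -!catA.
have := midemCk v' ff (midem_domain u'); rewrite -!catA => ->.
by rewrite mulVK.
Qed.

Lemma leM_inv u v : leM B u v -> leM B (invw u) (invw v).
Proof.
move=> [e [ee ue]]; exists (invw v ++ e ++ v); split.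
  by have := midem_conj (invw v) ee; rewrite invwK.
rewrite (invw_Mcong ue) invw_cat (midem_inv ee) -!catA.
have := midemC ee (midem_range v); rewrite -!catA => ->.
by rewrite VmulK.
Qed.

Lemma leM_nil e : midem e -> leM B e [::].
Proof. by move=> ee; exists e; rewrite cats0; split. Qed.

Lemma leM_range u : leM B (u ++ invw u) [::].
Proof. exact/leM_nil/midem_range. Qed.

Lemma leM_domain u : leM B (invw u ++ u) [::].
Proof. exact/leM_nil/midem_domain. Qed.

(** As H is closed upward, this is how a subword such as q^-1 q is cancelled inside a member of
    H. *)
Lemma leM_drop e u v : leM B e [::] -> leM B (u ++ e ++ v) (u ++ v).
Proof.
move=> e1; apply: leM_cat (leM_refl _) _.
by have := leM_cat e1 (leM_refl v).
Qed.

Lemma Lp_midem r : midem [:: Lp r].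
Proof. exact: Mc_idem. Qed.

Lemma genN_cat gens u v : genN gens u -> genN gens v -> genN gens (u ++ v).
Proof.
by move=> Hu Hv; elim: Hu => //= g w gi _ IH; rewrite -catA; [apply: gN_cons | apply: gN_consi].
Qed.

Lemma genN_inv gens u : genN gens u -> genN gens (invw u).
Proof.
elim=> [|g w gi _ IH|g w gi _ IH]; rewrite ?invw_cat; first exact: gN_nil.
  by apply: genN_cat IH _; rewrite -(cats0 (invw g)); apply: gN_consi gi (gN_nil _).
by apply: genN_cat IH _; rewrite invwK -(cats0 g); apply: gN_cons gi (gN_nil _).
Qed.

Lemma inHP gens w : inH B gens w <-> exists2 u, genN gens u & leM B u w.
Proof.
split=> [[n [[u [Gu nu]] nw]]|[u Gu uw]].
  by exists u => //; rewrite -nu.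
by exists u; split=> //; exists u; split.
Qed.

Lemma inH_le gens u v : leM B u v -> inH B gens u -> inH B gens v.
Proof. by move=> uv /inHP [n Gn nu]; apply/inHP; exists n => //; apply: leM_trans uv. Qed.

Lemma inH_nil gens : inH B gens [::].
Proof. by apply/inHP; exists [::]; [apply: gN_nil | apply: leM_refl]. Qed.

Lemma inH_gen gens g : List.In g gens -> inH B gens g.
Proof.
move=> gi; apply/inHP; exists (g ++ [::]); first exact: gN_cons gi (gN_nil _).
by rewrite cats0; apply: leM_refl.
Qed.

Lemma inH_cat gens u v : inH B gens u -> inH B gens v -> inH B gens (u ++ v).
Proof.
move=> /inHP [n Gn nu] /inHP [m Gm mv]; apply/inHP; exists (n ++ m).
  exact: genN_cat.
exact: leM_cat.
Qed.

Lemma inH_inv gens u : inH B gens u -> inH B gens (invw u).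
Proof.
move=> /inHP [n Gn nu]; apply/inHP; exists (invw n); first exact: genN_inv.
exact: leM_inv.
Qed.

(* In the complex of cosets of H, the word w leads from the coset of p to the coset of q. *)
Definition trans gens (p w q : word X P) := inH B gens (p ++ w ++ invw q).

Section Trans.
Variable gens : seq (word X P).
Local Notation T := (trans gens).

Lemma trans_le u v p q : leM B u v -> T p u q -> T p v q.
Proof.
by move=> uv; apply: inH_le; apply: leM_cat (leM_refl _) (leM_cat uv (leM_refl _)).
Qed.

Lemma trans_sym p u q : T p u q -> T q (invw u) p.
Proof. by move/inH_inv; rewrite !invw_cat invwK -!catA. Qed.

Lemma trans_cat q p u r v : T p u q -> T q v r -> T p (u ++ v) r.
Proof.
move=> pq qr; have := inH_cat pq qr; rewrite -!catA.
apply: inH_le; rewrite /trans.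
have := leM_drop (p ++ u) (v ++ invw r) (leM_domain q); rewrite -!catA; exact.
Qed.

Lemma trans_refl p u q : T p u q -> T p [::] p.
Proof.
by move=> pq; apply: trans_le (leM_range u) _; apply: trans_cat pq (trans_sym pq).
Qed.

Lemma trans_fold p u q r : T p u q -> T p u r -> T q [::] r.
Proof.
by move=> pq pr; apply: trans_le (leM_domain u) _; apply: trans_cat (trans_sym pq) pr.
Qed.

Lemma trans_prefix u v : inH B gens (u ++ v) -> T u [::] u.
Proof.
move=> uvH; have := inH_cat uvH (inH_inv uvH); rewrite invw_cat -catA.
apply: inH_le; rewrite /trans /=.
by have := leM_drop u (invw u) (leM_range v); rewrite -!catA.
Qed.

(** The step from [u] to [u ++ a] and the empty step at [u ++ a] spell the same word. *)
Lemma trans_step u a v : T (u ++ a) v (u ++ a) -> T u a (u ++ a).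
Proof. by move/trans_refl; rewrite /trans /= -catA. Qed.

End Trans.
End InverseMonoid.
(** * Action of M(X,P) on a labeled complex *)

Section SemiSimplicial.
Variables (cell : nat -> Type) (face : forall k, nat -> cell k.+1 -> cell k).
Hypothesis face_ss : is_ss face.

Lemma vert0_face k i (c : cell k.+1) :
  0 < i -> i <= k.+1 -> vert face 0 (face i c) = vert face 0 c.
Proof.
elim: k i c => [|k IH] i c i0 ik; first by rewrite (_ : i = 1) //; case: i i0 ik => [|[]].
have [-> //|ik'] : i = k.+2 \/ i < k.+2.
  by move: ik; rewrite leq_eqVlt => /orP [/eqP|]; [left | right].
rewrite -[RHS](_ : vert face 0 (face k.+2 c) = _) //.
rewrite -[LHS](_ : vert face 0 (face k.+1 (face i c)) = _) //.
by rewrite -(face_ss c ik') // IH.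
Qed.

Lemma edge_source k (c : cell k.+1) : face 1 (edge face c) = vert face 0 c.
Proof. by elim: k c => //= k IH c; rewrite IH. Qed.

Lemma edge_face k i (c : cell k.+2) :
  1 < i -> i <= k.+2 -> edge face (face i c) = edge face c.
Proof.
elim: k i c => [|k IH] i c i1 ik; first by rewrite (_ : i = 2) //; case: i i1 ik => [|[|[]]].
have [-> //|ik'] : i = k.+3 \/ i < k.+3.
  by move: ik; rewrite leq_eqVlt => /orP [/eqP|]; [left | right].
by rewrite /= -(face_ss c ik') // IH.
Qed.

Lemma edge_target k (c : cell k.+1) : face 0 (edge face c) = vert face 0 (face 0 c).
Proof.
by elim: k c => //= k IH c; rewrite IH (face_ss c).
Qed.

End SemiSimplicial.

(** * Words as partial injections of the vertices *)

Section Labels.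
Variables (X P : Type) (B : Bdata X P).
Local Notation bcell := (@cellB X P (bdim B)).
Local Notation bfc := (@bface X P B).

Lemma cellB_inj k (l l' : bcell k.+2) : proj1_sig l = proj1_sig l' -> l = l'.
Proof.
case: l l' => r E [r' E'] /= rr'; subst r'.
by rewrite (eq_irrelevance E E').
Qed.

(** An idempotent word that detects a cell at its root: an edge is traversed and undone, a higher
    cell has its own letter. *)
Definition cellw k : bcell k -> word X P :=
  match k as k0 return bcell k0 -> word X P with
  | 0 => fun _ => [::]
  | 1 => fun x => [:: Lx x; Lxi x]
  | k'.+2 => fun r => [:: Lp (proj1_sig r)]
  end.

Variables (cell : nat -> Type) (C : LC B cell).
Local Notation step := (step C).
Local Notation act := (act C).
Local Notation vx := (vert (lface C)).
Local Notation fc := (@lface _ _ _ _ C _).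
Local Notation T := (letter X P).
Implicit Types (p q : cell 0) (r : P) (a : T) (u v w z : seq T).

Lemma lab_edge k (c : cell k.+1) : lab C (edge (lface C) c) = edge bfc (lab C c).
Proof. by elim: k c => //= k IH c; rewrite IH lab_face. Qed.

Lemma step_edge k (c : cell k.+1) :
  step (vx 0 c) (Lx (edge bfc (lab C c))) (vx 0 (fc 0 c)).
Proof.
exists (edge (lface C) c); rewrite (edge_source (lface C)).
by rewrite (edge_target (lface_ss C)); split=> //; rewrite lab_edge.
Qed.

Lemma step_cell k (c : cell k.+2) (r : P) :
  proj1_sig (lab C c) = r -> step (vx 0 c) (Lp r) (vx 0 c).
Proof. by move=> <-; split=> //; exists k, c. Qed.

(** The dimension quantified in [step] is forced to be that of the letter [r]. *)
Lemma step_Lp p r k (l : bcell k.+2) : proj1_sig l = r ->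
  step p (Lp r) p -> exists c : cell k.+2, lab C c = l /\ vx 0 c = p.
Proof.
move=> lr [_ [k' [c [cr cp]]]].
have E : k' = k.
  have e1 : bdim B r = k.+2 by rewrite -lr; exact: proj2_sig l.
  have e2 : bdim B r = k'.+2 by rewrite -cr; exact: (proj2_sig (lab C c)).
  by move: e2; rewrite e1 => -[].
subst k'; exists c; split=> //; apply: cellB_inj; by rewrite lr.
Qed.

Lemma step_sym p a q : step p a q <-> step q (invl a) p.
Proof. by case: a => [x|x|r] //=; split=> -[-> ?]. Qed.

Lemma step_fun p a q q' : step p a q -> step p a q' -> q = q'.
Proof.
case: a => [x|x|r] /=; last by move=> [<- _] [<- _].
  move=> [e [ex [<- <-]]] [e' [ex' [ee <-]]]; congr (fc 0 _).
  by apply: (@lab_imm _ _ _ _ C 1 0) => //; rewrite ex ex'.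
move=> [e [ex [<- <-]]] [e' [ex' [<- ee]]]; congr (fc 1 _).
by apply: (@lab_imm _ _ _ _ C 1 1) => //; rewrite ex ex'.
Qed.

Lemma act_cat u v p q : act p (u ++ v) q <-> exists2 s, act p u s & act s v q.
Proof.
elim: u p => [|a u IH] p /=.
  split=> [H|[r H]]; first by exists p => //; constructor.
  by inversion H; subst.
split=> [H|[r H rq]].
  inversion H as [|? ? s ? ? pas suq]; subst.
  by have [r sr rq] := (IH s).1 suq; exists r => //; apply: act_cons sr.
inversion H as [|? ? s ? ? pas suq]; subst.
by apply: act_cons pas _; apply/IH; exists r.
Qed.

Lemma act1 p a q : act p [:: a] q <-> step p a q.
Proof.
split=> [H|H]; last by apply: act_cons H _; constructor.
inversion H as [|? ? s ? ? pas suq]; subst.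
by inversion suq; subst.
Qed.

Lemma act_invw p u q : act p (invw u) q <-> act q u p.
Proof.
suff H : forall u p q, act q u p -> act p (invw u) q.
  by split=> [/H|/H //]; rewrite invwK.
move=> {p q u}; elim=> [|a u IH] p q.
  by move=> H; inversion H; constructor.
rewrite -[a :: u]/([:: a] ++ u) invw_cat => /act_cat [r /act1 qr rp].
apply/act_cat; exists r; first exact: IH.
by apply/act1; apply/step_sym; case: (a) qr.
Qed.

Lemma act_fun u p q q' : act p u q -> act p u q' -> q = q'.
Proof.
elim: u p => [|a u IH] p H H'.
  by inversion H; inversion H'; subst.
inversion H as [|? ? s ? ? pas suq]; inversion H' as [|? ? s' ? ? pas' suq']; subst.
by rewrite -(step_fun pas pas') in suq'; apply: IH suq suq'.
Qed.

Lemma act_inj u p p' q : act p u q -> act p' u q -> p = p'.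
Proof. by move=> /act_invw H /act_invw; apply: act_fun H. Qed.

Lemma act_range u p q : act p (u ++ invw u) q <-> p = q /\ exists s, act p u s.
Proof.
split=> [/act_cat [r pr /act_invw qr]|[<- [r pr]]].
  by split; [apply: act_inj pr qr | exists r].
by apply/act_cat; exists r => //; apply/act_invw.
Qed.

(** A face omitting v_i with i > 0 keeps v_0, hence has the same root as [c]. *)
Lemma act_faces k (c : cell k.+3) (s : seq nat) : {in s, forall i, 0 < i <= k.+3} ->
  act (vx 0 c) [seq Lp (proj1_sig (bfc i (lab C c) : bcell k.+2)) | i <- s] (vx 0 c).
Proof.
elim: s => [|i s IH] Hs; first by constructor.
have /andP [i0 ik] := Hs i (mem_head _ _).
rewrite map_cons; apply: (@act_cons _ _ _ _ _ _ _ (vx 0 c)).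
  by rewrite -(vert0_face (lface_ss C) c i0 ik) -lab_face //; apply: step_cell.
by apply: IH => j js; apply: Hs; rewrite in_cons js orbT.
Qed.

Lemma act_blk k (c : cell k.+2) : act (vx 0 c) (blk (lab C c)) (vx 0 c).
Proof.
case: k c => [|k] c.
  have H i : i <= 2 -> step (vx 0 (fc i c)) (Lx (bfc i (lab C c)))
                            (fc 0 (fc i c)).
    by move=> i2; rewrite -lab_face //; exists (fc i c).
  apply: (@act_cons _ _ _ _ _ _ _ (fc 0 (fc 2 c))).
    by have := H 2 isT; rewrite (vert0_face (lface_ss C)).
  rewrite (lface_ss C (i := 0) (j := 2)) //.
  apply: act_cons (H 0 isT) _; apply/act1/step_sym.
  rewrite -(lface_ss C (i := 0) (j := 1) c) //.
  by have := H 1 isT; rewrite (vert0_face (lface_ss C)).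
apply/act_cat; exists (vx 0 c).
  have -> : [seq Lp (proj1_sig (bfc (k.+3 - j) (lab C c) : bcell k.+2)) | j <- iota 0 k.+3]
    = [seq Lp (proj1_sig (bfc i (lab C c) : bcell k.+2)) | i <- [seq k.+3 - j | j <- iota 0 k.+3]].
    by move=> ?; rewrite -map_comp.
  apply: act_faces => i /mapP [j]; rewrite mem_iota add0n /= => jk ->.
  by rewrite subn_gt0 jk leq_subr.
apply: (act_cons (step_edge c)).
apply: (act_cons (w := [:: Lxi _])).
  by have := step_cell (c := fc 0 c) (erefl _); rewrite lab_face //; apply.
by apply/act1/step_sym; apply: step_edge.
Qed.

(** Makes the action one of M(X,P). The inverse monoid axioms hold because letters act by partial
    injections, the relation rho = rho bl(rho) because the boundary label of a cell is read along a
    loop at its root. *)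
Lemma act_Mcong u v : Mcong B u v -> forall p q, act p u q <-> act p v q.
Proof.
elim=> {u v} [u|u v _ IH|u v w _ IH1 _ IH2|a b u v _ IH|w|w z|r|k c] p q //.
- by split=> /IH.
- by split=> [/IH1/IH2|/IH2/IH1].
- by split=> /act_cat [x px /act_cat [y xy yq]]; apply/act_cat; exists x => //;
    apply/act_cat; exists y => //; apply/IH.
- split=> [|pq]; last by rewrite catA; apply/act_cat; exists p => //; apply/act_range; split=> //; exists q.
  by rewrite catA => /act_cat [x /act_range [-> _]].
- suff H : forall w z p q, act p (w ++ invw w ++ z ++ invw z) q ->
      act p (z ++ invw z ++ w ++ invw w) q by split; apply: H.
  clear w z p q => w z p q; rewrite catA => /act_cat [x /act_range [<- Hw] /act_range [<- Hz]].
  by rewrite catA; apply/act_cat; exists p; apply/act_range.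
- split=> [/(act_cat [:: Lp r])[x /act1 []]|H]; first by move=> <- _.
  apply/(act_cat [:: Lp r] [:: Lp r]); exists p => //.
  by case/act1: (H) => -> H'; apply/act1.
- rewrite -[_ :: blk _]/([:: _] ++ _); split=> [H|/act_cat [x /act1 px xq]].
    move/act1: (H) => H1; case: (H1) => pq _; subst q.
    apply/act_cat; exists p => //.
    have [d [<- <-]] := step_Lp (erefl _) H1; exact: act_blk.
  case: (px) => px' _; subst x; apply/act1.
  have [d [dc dp]] := step_Lp (erefl _) px; subst c p.
  by rewrite (act_fun xq (act_blk d)).
Qed.

Lemma act_midem e p q : midem B e -> act p e q -> p = q.
Proof.
move=> ee pq; have := (act_Mcong ee p q).2 pq.
move=> /act_cat [r pr rq]; rewrite (act_fun pr pq) in rq.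
exact: act_inj pq rq.
Qed.

Lemma act_leM u v p q : leM B u v -> act p u q -> act p v q.
Proof.
move=> [e [ee /act_Mcong ue]] /ue /act_cat [r pr rq].
by rewrite (act_midem ee pr).
Qed.

(** A loop monoid is a closed inverse submonoid, so it contains H as soon as it contains the
    generators. *)
Lemma loopw_inH gens p w :
  (forall g, List.In g gens -> loopw C p g) -> inH B gens w -> loopw C p w.
Proof.
move=> Hg /inHP [u Gu uw]; apply: act_leM uw _.
elim: Gu => [|g z gi _ IH|g z gi _ IH]; first by constructor.
  by apply/act_cat; exists p => //; apply: Hg.
by apply/act_cat; exists p => //; apply/act_invw; apply: Hg.
Qed.

Lemma act_cellw k (l : bcell k) p :
  act p (cellw l) p <-> exists c : cell k, vx 0 c = p /\ lab C c = l.
Proof.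
case: k l => [|[|k]] l.
- by split=> [_|_]; [exists p; case: l (lab C p) => -[] | constructor].
- rewrite -[cellw l]/([:: Lx l] ++ invw [:: Lx l]).
  split=> [/act_range [_ [q /act1 [e [el [ep _]]]]]|[e [ep el]]]; first by exists e.
  by apply/act_range; split=> //; exists (fc 0 e); apply/act1; exists e.
- split=> [/act1 H|[c [<- <-]]]; last by apply/act1/step_cell.
  by have [c [? ?]] := step_Lp (erefl _) H; exists c.
Qed.

Lemma connected_act p q : connected C -> exists u, act p u q.
Proof.
move=> /(_ p q); elim=> {p q} [p q [e [ep eq]]|p|p q _ [u pq]|p q r _ [u pq] _ [v qr]].
- by exists [:: Lx (lab C e : X)]; apply/act1; exists e.
- by exists [::]; constructor.
- by exists (invw u); apply/act_invw.
- by exists (u ++ v); apply/act_cat; exists q.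
Qed.

End Labels.

(** * Comparison of connected complexes with equal loop monoids *)

Lemma finite_complex_transfer (X P : Type) (B : Bdata X P) (cell cell' : nat -> Type)
    (C : LC B cell) (C' : LC B cell') (v : cell 0) (v' : cell' 0) :
  connected C -> connected C' -> (forall w, loopw C v w <-> loopw C' v' w) ->
  finite_complex cell -> finite_complex cell'.
Proof.
move=> conn conn' L fin k.
have [s Hs] := fin k.
(* Two words from the base end at the same vertex when [u ++ invw w] is a loop, so equal loop
   monoids make this relation functional, total and onto. *)
pose R (c : cell k) (c' : cell' k) := lab C c = lab C' c' /\
  exists u, act C v u (vert (lface C) 0 c) /\ act C' v' u (vert (lface C') 0 c').
have R_onto c' : exists c, R c c'.
  have [u Hu] := connected_act v' (vert (lface C') 0 c') conn'.
  have : loopw C' v' (u ++ cellw (lab C' c') ++ invw u).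
    apply/act_cat; exists (vert (lface C') 0 c') => //.
    apply/act_cat; exists (vert (lface C') 0 c'); last exact/act_invw.
    by apply/act_cellw; exists c'.
  move/L => /act_cat [x vx /act_cat [y xy /act_invw vy]].
  rewrite (act_fun vy vx) in xy; case/act_cellw: xy => c [cx cl].
  by exists c; split=> //; exists u; rewrite cx.
have R_fun c c1 c2 : R c c1 -> R c c2 -> c1 = c2.
  move=> [l1 [u [vu vu']]] [l2 [w [vw vw']]].
  apply: (@lab_imm _ _ _ _ C' k 0) => //; last by rewrite -l1 -l2.
  have : loopw C v (u ++ invw w).
    by apply/act_cat; exists (vert (lface C) 0 c) => //; apply/act_invw.
  by move/L => /act_cat [x vx /act_invw xv]; rewrite (act_fun vu' vx) (act_fun vw' xv).
have R_tot c : exists c', R c c'.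
  have [u Hu] := connected_act v (vert (lface C) 0 c) conn.
  have : loopw C v (u ++ cellw (lab C c) ++ invw u).
    apply/act_cat; exists (vert (lface C) 0 c) => //.
    apply/act_cat; exists (vert (lface C) 0 c); last exact/act_invw.
    by apply/act_cellw; exists c.
  move/L => /act_cat [x vx /act_cat [y xy /act_invw vy]].
  rewrite (act_fun vy vx) in xy; case/act_cellw: xy => c' [cx cl].
  by exists c'; split=> //; exists u; rewrite cx.
(* An image under [R] merely exists, so the list of images is assembled by induction instead of
   mapping a function. *)
have [s' Hs'] : exists s', forall c c', List.In c s -> R c c' -> List.In c' s'.
  elim: (s) => [|c t [t' Ht]]; first by exists nil.
  have [c' Rc] := R_tot c; exists (c' :: t') => d d' /= [<-|dt] Rd.
    by left; apply: R_fun Rc Rd.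
  by right; apply: Ht Rd.
by exists s' => c'; have [c Rc] := R_onto c'; apply: Hs' Rc.
Qed.
(** * Faces of the cells of B as inequalities in M(X,P) *)

Section Boundaries.
Variables (X : eqType) (P : Type) (B : Bdata X P).
Local Notation bcell := (@cellB X P (bdim B)).
Local Notation bfc := (@bface X P B).

Lemma bdimE r : bdim B r = (bdim B r).-2.+2.
Proof. by case: (bdim B r) (bdim_ge2 B r) => [|[]]. Qed.

Definition Pcell (r : P) : bcell (bdim B r).-2.+2 := exist _ r (bdimE r).

(** A family over all dimensions cannot tell [c] from [Pcell] of its letter. Through it, functions
    of cells are used as functions of letters, without casts. *)
Lemma Pcell_elim (A : Type) (f : forall k, bcell k.+2 -> A) k (c : bcell k.+2) :
  f _ (Pcell (proj1_sig c)) = f k c.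
Proof.
have E : k = (bdim B (proj1_sig c)).-2 by rewrite (proj2_sig c).
by case: c E => r Er /= E; subst k; congr f; apply: cellB_inj.
Qed.

Definition sidefaces k : bcell k.+2 -> seq P :=
  match k with
  | 0 => fun _ => [::]
  | m.+1 => fun c => [seq proj1_sig (bfc i c : bcell m.+2) | i <- iota 1 m.+3]
  end.

Definition bottoms k : bcell k.+2 -> seq (X * P) :=
  match k with
  | 0 => fun _ => [::]
  | m.+1 => fun c => [:: (edge bfc c : X, proj1_sig (bfc 0 c : bcell m.+2))]
  end.

Definition triangles k : bcell k.+2 -> seq (X * X * X) :=
  match k with
  | 0 => fun c => [:: (bfc 2 c, bfc 1 c, bfc 0 c)]
  | _ => fun _ => [::]
  end.

(* The labels of the edges joining the root v_0 to the other vertices. *)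
Fixpoint spokes k : bcell k.+1 -> seq X :=
  match k with
  | 0 => fun x => [:: x]
  | m.+1 => fun c => flatten [seq spokes (bfc i c) | i <- iota 1 m.+2]
  end.

Lemma spokes_face k i (c : bcell k.+2) x :
  0 < i <= k.+2 -> x \in spokes (bfc i c) -> x \in spokes c.
Proof.
move=> ik xi; apply/flatten_mapP; exists i => //.
by rewrite mem_iota add1n ltnS.
Qed.

Lemma edge_spoke k (c : bcell k.+1) : (edge bfc c : X) \in spokes c.
Proof.
elim: k c => [|k IH] c; first by rewrite mem_seq1.
by apply: (@spokes_face _ k.+2); rewrite ?leqnn //; apply: IH.
Qed.

(** A spoke of the bottom face is an edge [v_1,v_i], the bottom of the triangle [v_0,v_1,v_i]. That
    triangle is reached from [c] by passing to side faces only, and [Q] carries along what is known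
    of [c]. *)
Lemma spokes_bottom (Q : forall k, bcell k.+2 -> Prop) :
  (forall k i (c : bcell k.+3), 0 < i <= k.+3 -> Q _ c -> Q _ (bfc i c)) ->
  forall k (c : bcell k.+2) x, Q _ c -> x \in spokes (bfc 0 c) ->
  exists t : bcell 2, [/\ Q _ t, bfc 0 t = x & bfc 2 t = edge bfc c].
Proof.
move=> HQ; elim=> [|k IH] c x Qc.
  by rewrite mem_seq1 => /eqP ->; exists c.
case/flatten_mapP=> i; rewrite mem_iota add1n ltnS => /andP [i0 ik].
have ss := @bface_ss _ _ B; rewrite -(ss k.+1 0 i.+1) // => xi.
have [|t [Qt tx te]] := IH (bfc i.+1 c) x _ xi; first exact: HQ.
by exists t; split=> //; rewrite te (edge_face ss).
Qed.

Lemma leM_Lps (s : seq P) : leM B [seq Lp r | r <- s] [::].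
Proof.
elim: s => [|r s IH]; first exact: leM_refl.
exact: leM_cat (leM_nil (Lp_midem B r)) IH.
Qed.

Lemma leM_conj_nil w e : leM B e [::] -> leM B (w ++ e ++ invw w) [::].
Proof.
by move=> e1; apply: leM_trans (leM_drop w (invw w) e1) _; apply: leM_range.
Qed.

Lemma sideface_le k i (c : bcell k.+3) : 0 < i <= k.+3 ->
  leM B [:: Lp (proj1_sig c)] [:: Lp (proj1_sig (bfc i c : bcell k.+2))].
Proof.
move=> /andP [i0 ik]; apply: leM_trans (leM_eq (Mc_bl c)) _.
pose f j := Lp (X := X) (proj1_sig (bfc (k.+3 - j) c : bcell k.+2)).
have /splitPr Hs : k.+3 - i \in iota 0 k.+3 by rewrite mem_iota add0n ltn_subrL i0.
rewrite /blk; case: Hs => s1 s2.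
have nil1 s : leM B [seq f j | j <- s] [::].
  by rewrite (_ : map f s = map Lp (map (fun j => proj1_sig (bfc (k.+3 - j) c : bcell k.+2)) s));
    [apply: leM_Lps | rewrite -map_comp].
rewrite map_cat map_cons subKn //= -/f.
have := leM_cat (leM_nil (Lp_midem B (proj1_sig c))) (leM_cat (nil1 s1) (leM_cat
  (leM_refl B [:: Lp (proj1_sig (bfc i c : bcell k.+2))]) (leM_cat (nil1 s2)
  (leM_conj_nil [:: Lx (edge bfc c : X)]
    (leM_nil (Lp_midem B (proj1_sig (bfc 0 c : bcell k.+2)))))))).
by rewrite -catA.
Qed.

(** Solves rho <= e rho_0 e^-1 for rho_0: multiply by e^-1 and e, then drop e^-1 e on either side.
    The triangle inequality below solves rho <= x y z^-1 for y in the same way. *)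
Lemma bottom_le k (c : bcell k.+3) :
  leM B [:: Lxi (edge bfc c : X); Lp (proj1_sig c); Lx (edge bfc c : X)]
        [:: Lp (proj1_sig (bfc 0 c : bcell k.+2))].
Proof.
set e : X := edge bfc c.
set r0 := proj1_sig (bfc 0 c : bcell k.+2).
have H : leM B [:: Lp (proj1_sig c)] ([:: Lx e] ++ [:: Lp r0] ++ [:: Lxi e]).
  apply: leM_trans (leM_eq (Mc_bl c)) _; rewrite /blk -/e -/r0.
  have := leM_Lps (proj1_sig c :: [seq proj1_sig (bfc (k.+3 - j) c : bcell k.+2) | j <- iota 0 k.+3]).
  by rewrite map_cons -map_comp => H; apply: leM_cat H (leM_refl B _).
have := leM_cat (leM_refl B [:: Lxi e]) (leM_cat H (leM_refl B [:: Lx e])).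
move/leM_trans; apply.
have := leM_cat (leM_domain B [:: Lx e]) (leM_cat (leM_refl B [:: Lp r0]) (leM_domain B [:: Lx e])).
exact.
Qed.

Lemma triangle_le (c : bcell 2) :
  leM B [:: Lxi (bfc 2 c : X); Lp (proj1_sig c); Lx (bfc 1 c : X)] [:: Lx (bfc 0 c : X)].
Proof.
set x : X := bfc 2 c; set z : X := bfc 1 c; set y : X := bfc 0 c.
have H : leM B [:: Lp (proj1_sig c)] [:: Lx x; Lx y; Lxi z].
  apply: leM_trans (leM_eq (Mc_bl c)) _.
  exact: leM_cat (leM_nil (Lp_midem B _)) (leM_refl B _).
have := leM_cat (leM_refl B [:: Lxi x]) (leM_cat H (leM_refl B [:: Lx z])).
move/leM_trans; apply.
have := leM_cat (leM_domain B [:: Lx x]) (leM_cat (leM_refl B [:: Lx y]) (leM_domain B [:: Lx z])).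
exact.
Qed.

Lemma midem_le_range e u w : midem B e -> leM B e (u ++ w) -> leM B e (u ++ invw u).
Proof.
move=> ee H; apply: leM_trans (leM_eq (Mc_sym (midem_range_eq ee))) _.
apply: leM_trans (leM_cat H (leM_inv H)) _; rewrite invw_cat -catA.
by have := leM_drop u (invw u) (leM_range B w); rewrite -!catA.
Qed.

Lemma spoke_le k (c : bcell k.+2) x : x \in spokes c ->
  leM B [:: Lp (proj1_sig c)] [:: Lx x; Lxi x].
Proof.
elim: k c => [|k IH] c.
  rewrite /= inE mem_seq1 => xc.
  have H : leM B [:: Lp (proj1_sig c)] [:: Lx (bfc 2 c : X); Lx (bfc 0 c : X); Lxi (bfc 1 c : X)].
    apply: leM_trans (leM_eq (Mc_bl c)) _.
    exact: leM_cat (leM_nil (Lp_midem B _)) (leM_refl B _).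
  case/orP: xc => /eqP ->.
    (* [bfc 1 c] closes the boundary label as an inverse letter, hence it opens the inverse word,
       while the letter of [c] is its own inverse. *)
    exact: (@midem_le_range _ [:: _] [:: Lxi _; Lxi _] (Lp_midem B _) (leM_inv H)).
  exact: (@midem_le_range _ [:: _] [:: _; _] (Lp_midem B _) H).
case/flatten_mapP=> i; rewrite mem_iota add1n ltnS => ik /IH.
exact/leM_trans/sideface_le.
Qed.

End Boundaries.
(** * Complexes from roots and labels *)

(* Cells are encoded as pairs (root, label), which is faithful because a labeled complex is
   locally injective; the faces are then forced by those of B and by the edge action [tgt]. *)
Section RootedComplex.
Variables (X P : Type) (B : Bdata X P).
Local Notation bcell := (@cellB X P (bdim B)).
Local Notation bfc := (@bface X P B).
Local Notation bedge l := (edge bfc l : X).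
Variables (V : Type) (valid : forall k, V -> bcell k -> Prop) (tgt : V -> X -> V).
Hypothesis valid_side : forall k i p (l : bcell k.+1),
  0 < i <= k.+1 -> valid p l -> valid p (bfc i l).
Hypothesis valid_bottom : forall k p (l : bcell k.+1),
  valid p l -> valid (tgt p (bedge l)) (bfc 0 l).
Hypothesis tgt_triangle : forall k p (l : bcell k.+2),
  valid p l -> tgt (tgt p (bedge l)) (bedge (bfc 0 l)) = tgt p (bedge (bfc 1 l)).
Hypothesis tgt_inj : forall p q x,
  @valid 1 p x -> @valid 1 q x -> tgt p x = tgt q x -> p = q.

Variables (cell : nat -> Type) (root : forall k, cell k -> V) (clab : forall k, cell k -> bcell k).
Variable mk : forall k p (l : bcell k), valid p l -> cell k.
Hypothesis root_mk : forall k p (l : bcell k) (h : valid p l), root (mk h) = p.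
Hypothesis clab_mk : forall k p (l : bcell k) (h : valid p l), clab (mk h) = l.
Hypothesis cell_valid : forall k (c : cell k), valid (root c) (clab c).
Hypothesis cell_inj : forall k (c c' : cell k), root c = root c' -> clab c = clab c' -> c = c'.

(* An index i > k+1 is meaningless; it gets the bottom face. *)
Definition rface k (i : nat) (c : cell k.+1) : cell k :=
  match (0 < i <= k.+1) =P true with
  | ReflectT h => mk (valid_side h (cell_valid c))
  | ReflectF _ => mk (valid_bottom (cell_valid c))
  end.

Lemma root_side k i (c : cell k.+1) : 0 < i <= k.+1 -> root (rface i c) = root c.
Proof. by rewrite /rface; case: eqP => // h _; rewrite root_mk. Qed.

Lemma root_bottom k (c : cell k.+1) : root (rface 0 c) = tgt (root c) (bedge (clab c)).
Proof. by rewrite /rface; case: eqP => // h; rewrite root_mk. Qed.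

Lemma clab_rface k i (c : cell k.+1) : i <= k.+1 -> clab (rface i c) = bfc i (clab c).
Proof.
rewrite /rface; case: eqP => h ik; rewrite clab_mk //.
by case: i ik h => // i -> [].
Qed.

(** Labels satisfy the identity in [B], so only roots are at stake, and they move only when v_0 is
    dropped. For i = 0 and j > 1 the first edge is unaffected by omitting v_j; for i = 0 and j = 1
    both sides are rooted at v_2, which is [tgt_triangle]. *)
Lemma rface_ss : is_ss rface.
Proof.
have ss := @bface_ss _ _ B.
move=> k i j c ij jk.
have [i1 i2] : i <= k.+2 /\ i <= k.+1.
  by split; [exact: ltnW (leq_trans ij jk) | exact: leq_trans ij jk].
have j0 : 0 < j by apply: leq_ltn_trans ij.
have j1 : j.-1 <= k.+1 by rewrite -ltnS prednK.
apply: cell_inj; last by rewrite !clab_rface // ss.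
case: i ij i1 i2 => [|i] ij i1 i2.
  rewrite root_bottom clab_rface // root_side ?j0 //.
  have [j1'|] := ltnP 1 j.
    rewrite root_side; last by rewrite j1 -ltnS prednK // j1'.
    by rewrite root_bottom; congr tgt; apply: (edge_face ss).
  case: j ij jk j0 j1 => [|[|j]] // *.
  by rewrite !root_bottom clab_rface // tgt_triangle //; apply: cell_valid.
rewrite !root_side ?j0 ?i1 ?i2 //.
by rewrite j1 -ltnS prednK // (leq_trans _ ij).
Qed.

Lemma root_vert0 k (c : cell k) : root (vert rface 0 c) = root c.
Proof. by elim: k c => //= k IH c; rewrite IH root_side ?leqnn. Qed.

(** Unless v_i is the last vertex, the last face contains it and still shows the root. For the last
    vertex the bottom face is used; it has lost the root, which [tgt_inj] recovers from the end of
    the first edge. *)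
Lemma rvert_inj k i (c c' : cell k) : i <= k ->
  vert rface i c = vert rface i c' -> clab c = clab c' -> c = c'.
Proof.
elim: k i c c' => [|k IH] i c c' ik //= vv ll.
apply: cell_inj => //.
have [i'|i'] := ltnP i k.+1; rewrite ?i' in vv.
  have E : rface k.+1 c = rface k.+1 c'.
    by apply: IH vv _; rewrite // !clab_rface // ll.
  by rewrite -(@root_side k k.+1 c) ?leqnn // E root_side ?leqnn.
rewrite ltnNge i' /= in vv.
have E : rface 0 c = rface 0 c' by apply: IH vv _; rewrite // !clab_rface // ll.
have /= := root_bottom c; rewrite E root_bottom ll => /esym.
have valid_edge (d : cell k.+1) : @valid 1 (root d) (bedge (clab d)).
  elim: {c c' ik i i' ll E vv IH} k d => [|k IH] d; first exact: (cell_valid d).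
  by have := IH (rface k.+2 d); rewrite root_side ?leqnn // clab_rface.
by have := valid_edge c; rewrite ll => vc; apply: tgt_inj vc (valid_edge c').
Qed.

Lemma root_inj0 (v w : cell 0) : root v = root w -> v = w.
Proof. by move=> /cell_inj; apply; case: (clab v) (clab w) => -[]. Qed.

Definition rooted_complex : LC B cell :=
  {| lface := rface; lface_ss := rface_ss; lab := clab; lab_face := clab_rface;
     lab_imm := rvert_inj |}.

Lemma step_rooted_Lx v x w : step rooted_complex v (Lx x) w <->
  @valid 1 (root v) x /\ tgt (root v) x = root w.
Proof.
split=> [[e /= [<- [<- <-]]]|[vx tx]].
  by rewrite root_side // root_bottom; split=> //; apply: cell_valid.
exists (mk vx) => /=; rewrite clab_mk; split=> //.
split; apply: root_inj0; first by rewrite root_side // root_mk.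
by rewrite root_bottom root_mk clab_mk; exact: tx.
Qed.

Lemma step_rooted_Lp v r w : step rooted_complex v (Lp r) w <->
  v = w /\ exists k (l : bcell k.+2), proj1_sig l = r /\ valid (root v) l.
Proof.
split=> [[vw [k [c [cr cv]]]]|[<- [k [l [lr vl]]]]]; split=> //.
  exists k, (clab c); split=> //.
  by have /= := root_vert0 c; rewrite -cv => ->; apply: cell_valid.
exists k, (mk vl); rewrite /= clab_mk; split=> //.
by apply: root_inj0; have := root_vert0 (mk vl); rewrite root_mk.
Qed.

End RootedComplex.
(** * Folding *)

Section LetterFinite.
Variables X P : Type.

Definition letter_code (a : letter X P) : X + X + P :=
  match a with Lx x => inl (inl x) | Lxi x => inl (inr x) | Lp r => inr r end.

Definition letter_decode (c : X + X + P) : letter X P :=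
  match c with inl (inl x) => Lx x | inl (inr x) => Lxi x | inr r => Lp r end.

Lemma letter_codeK : cancel letter_code letter_decode.
Proof. by case. Qed.
End LetterFinite.

HB.instance Definition _ (X P : finType) :=
  Finite.copy (letter X P) (can_type (@letter_codeK X P)).

(** * Least fixed point of a set of rules *)

Section Derivation.
Variables (F : finType) (n : nat) (rule : seq F -> pred F).

(** Premises are sequences of bounded length, so the quantifier over them ranges over a finite type
    and is boolean. *)
Definition derive_step (S : {set F}) : {set F} :=
  [set f | [exists t : n.-bseq F, all (mem S) t && rule t f]].

Lemma derive_step_mono : {homo derive_step : S S' / S \subset S'}.
Proof.
move=> S S' SS'; apply/subsetP=> f; rewrite !inE => /existsP [t /andP [tS tf]].
apply/existsP; exists t; rewrite tf andbT.
by apply/allP=> g /(allP tS) /= /(subsetP SS').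
Qed.

Definition derivable : {set F} := fixset derive_step.

Lemma derivable_rule (ps : seq F) f :
  size ps <= n -> rule ps f -> {subset ps <= derivable} -> f \in derivable.
Proof.
move=> sz rf psD; rewrite /derivable -(fixsetK derive_step_mono) inE.
apply/existsP; exists (Bseq sz); rewrite rf andbT.
by apply/allP=> g /psD.
Qed.

(** Premises come with their derivability as well as with [Q], so that derived rules can be applied
    inside an induction. *)
Lemma derivable_ind (Q : F -> Prop) :
  (forall (ps : seq F) f, rule ps f -> (forall g, g \in ps -> g \in derivable /\ Q g) -> Q f) ->
  forall f, f \in derivable -> Q f.
Proof.
move=> HQ.
suff H m f : f \in iter m derive_step set0 -> Q f by apply: H.
elim: m f => [|m IH] f; first by rewrite inE.
rewrite inE => /existsP [t /andP [tS tf]]; apply: HQ tf _ => g /(allP tS) /= gm.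
split; last exact: IH.
exact: (subsetP (iter_sub_fix derive_step_mono m)).
Qed.

End Derivation.

(** * Facts, rules and their soundness *)

Section Folding.
Variables (X P : finType) (B : Bdata X P) (V : finType).
Local Notation bcell := (@cellB X P (bdim B)).
Local Notation bfc := (@bface X P B).
Local Notation bedge l := (edge bfc l : X).
Definition fact : finType := (V * option (letter X P) * V)%type.
Variable init : pred fact.

(* A fact (p, a, q) says that the letter a leads from p to q, or, for a = None, that p and q
   are to be identified. A cell labeled r attached at p is the fact (p, Lp r, p). The rules
   add no vertex: a cell only produces its faces on the edges already issuing from its root. *)
Definition fold_rule (ps : seq fact) (f : fact) : bool :=
  let: (p, a, q) := f in
  match ps with
  | [::] => init f
  | [:: (p1, a1, q1)] =>
      [|| [&& p == q1, a == omap (@invl X P) a1 & q == p1],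
          [&& p == p1, a == None & q == p1],
          [&& p == p1, a == None, q == q1 & if a1 is Some (Lp _) then true else false] |
          [&& p == p1, q == p1, q1 == p1 & if (a1, a) is (Some (Lp r1), Some (Lp r))
                             then r \in sidefaces (Pcell B r1) else false]]
  | [:: (p1, a1, q1); (p2, a2, q2)] =>
      [|| [&& p == p1, a1 == None, q1 == p2, a == a2 & q == q2],
          [&& p1 == p2, a1 == a2, p == q1, a == None & q == q2] |
          [&& p1 == q1, p2 == p1, p == q2, q == q2 &
             if (a1, a2, a) is (Some (Lp r1), Some (Lx x), Some (Lp r))
             then (x, r) \in bottoms (Pcell B r1) else false]]
  | [:: (p1, a1, q1); (p2, a2, q2); (p3, a3, q3)] =>
      [&& p1 == q1, p2 == p1, p3 == p1, p == q2, q == q3 &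
        if (a1, a2, a3, a) is (Some (Lp r), Some (Lx x), Some (Lx z), Some (Lx y))
        then (x, z, y) \in triangles (Pcell B r) else false]
  | _ => false
  end.

(** The triangle rule has the most premises, three: a 2-cell and its two edges at the root. *)
Definition derived : {set fact} := derivable 3 fold_rule.
Local Notation D p a q := ((p, a, q) \in derived).

Lemma derived_init f : init f -> f \in derived.
Proof. by case: f => [[p a] q] H; apply: (@derivable_rule _ _ _ [::]). Qed.

Lemma derived_sym p a q : D p a q -> D q (omap (@invl X P) a) p.
Proof.
move=> H; apply: (@derivable_rule _ _ _ [:: (p, a, q)]) => //=; first by rewrite !eqxx.
by move=> f; rewrite inE => /eqP ->.
Qed.

Lemma derived_refl p a q : D p a q -> D p None p.
Proof.
move=> H; apply: (@derivable_rule _ _ _ [:: (p, a, q)]) => //=; first by rewrite !eqxx orbT.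
by move=> f; rewrite inE => /eqP ->.
Qed.

Lemma derived_idem p r q : D p (Some (Lp r)) q -> D p None q.
Proof.
move=> H; apply: (@derivable_rule _ _ _ [:: (p, Some (Lp r), q)]) => //=.
  by rewrite !eqxx !orbT.
by move=> f; rewrite inE => /eqP ->.
Qed.

Lemma derived_comp q p a r : D p None q -> D q a r -> D p a r.
Proof.
move=> H1 H2; apply: (@derivable_rule _ _ _ [:: (p, None, q); (q, a, r)]) => //=.
  by rewrite !eqxx.
by move=> f; rewrite !inE => /orP [/eqP ->|/eqP ->].
Qed.

Lemma derived_fold p a q r : D p a q -> D p a r -> D q None r.
Proof.
move=> H1 H2; apply: (@derivable_rule _ _ _ [:: (p, a, q); (p, a, r)]) => //=.
  by rewrite !eqxx !orbT.
by move=> f; rewrite !inE => /orP [/eqP ->|/eqP ->].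
Qed.

Lemma derived_eq_sym p q : D p None q -> D q None p.
Proof. exact: derived_sym. Qed.

Lemma derived_compr q p a r : D p a q -> D q None r -> D p a r.
Proof.
move=> H1 /derived_eq_sym H2.
have := derived_sym (derived_comp H2 (derived_sym H1)).
by case: a {H1} => //= a; rewrite invlK.
Qed.

Lemma derived_move p p' a q q' :
  D p None p' -> D q None q' -> D p a q -> D p' a q'.
Proof.
by move=> /derived_eq_sym pp' qq' pq; apply: derived_comp pp' (derived_compr pq qq').
Qed.

Local Notation Dcell p l := (D p (Some (Lp (proj1_sig l))) p).

Lemma derived_side p k i (l : bcell k.+3) : 0 < i <= k.+3 ->
  Dcell p l -> Dcell p (bfc i l : bcell k.+2).
Proof.
move=> ik H; apply: (@derivable_rule _ _ _ [:: (p, Some (Lp (proj1_sig l)), p)]) => //=.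
  rewrite !eqxx /= (Pcell_elim (@sidefaces X P B) l).
  by rewrite (_ : _ \in _) ?orbT //; apply/mapP; exists i; rewrite ?mem_iota ?add1n ?ltnS.
by move=> f; rewrite inE => /eqP ->.
Qed.

Lemma derived_bottom p q k (l : bcell k.+3) :
  Dcell p l -> D p (Some (Lx (bedge l))) q -> Dcell q (bfc 0 l : bcell k.+2).
Proof.
move=> H1 H2.
apply: (@derivable_rule _ _ _ [:: (p, Some (Lp (proj1_sig l)), p);
                                 (p, Some (Lx (bedge l)), q)]) => //=.
  by rewrite !eqxx /= (Pcell_elim (@bottoms X P B) l) /= mem_seq1 eqxx !orbT.
by move=> f; rewrite !inE => /orP [/eqP ->|/eqP ->].
Qed.

Lemma derived_triangle p q r (l : bcell 2) :
  Dcell p l -> D p (Some (Lx (bfc 2 l : X))) q -> D p (Some (Lx (bfc 1 l : X))) r ->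
  D q (Some (Lx (bfc 0 l : X))) r.
Proof.
move=> H1 H2 H3.
apply: (@derivable_rule _ _ _ [:: (p, Some (Lp (proj1_sig l)), p);
   (p, Some (Lx (bfc 2 l : X)), q); (p, Some (Lx (bfc 1 l : X)), r)]) => //=.
  by rewrite !eqxx /= (Pcell_elim (@triangles X P B) l) /= mem_seq1 eqxx.
by move=> f; rewrite !inE => /or3P [/eqP ->|/eqP ->|/eqP ->].
Qed.

Definition optw (a : option (letter X P)) : word X P := if a is Some b then [:: b] else [::].

(** The identification rules are the groupoid-like laws of [trans], and the cell rules are the
    inequalities for faces, so only the initial facts remain to be checked. *)
Lemma derived_sound gens (tau : V -> word X P) :
  (forall p a q, init (p, a, q) -> trans B gens (tau p) (optw a) (tau q)) ->
  forall f, f \in derived -> trans B gens (tau f.1.1) (optw f.1.2) (tau f.2).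
Proof.
move=> Hinit; apply: derivable_ind => ps [[p a] q] /=.
case: ps => [|[[p1 a1] q1] [|[[p2 a2] q2] [|[[p3 a3] q3] [|? ?]]]] //=.
- by move=> /Hinit.
- move=> rf /(_ _ (mem_head _ _)) [_ /= H1].
  case/or4P: rf.
  + case/and3P=> /eqP -> /eqP -> /eqP ->.
    by move/trans_sym: H1; case: a1.
  + by case/and3P=> /eqP -> /eqP -> /eqP ->; apply: trans_refl H1.
  + case/and4P=> /eqP -> /eqP -> /eqP ->; case: a1 H1 => [[x|x|r]|] // H1 _.
    by apply: trans_le H1; apply/leM_nil/Lp_midem.
  + case/and4P=> /eqP -> /eqP -> /eqP E; case: a1 H1 => [[x|x|r1]|] //; rewrite {}E => H1.
    case: a => [[x|x|r]|] // side; apply: trans_le H1.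
    rewrite -[r1]/(proj1_sig (Pcell B r1)); move: (Pcell B r1) side.
    move: (bdim B r1).-2 => [|k] // c /mapP [i]; rewrite mem_iota add1n ltnS => ik ->.
    exact: sideface_le.
- move=> rf Hps.
  have [_ /= H1] := Hps _ (mem_head _ _).
  have [|_ /= H2] := Hps (p2, a2, q2); first by rewrite !inE eqxx orbT.
  case/or3P: rf {Hps}.
  + case/and5P=> /eqP -> /eqP E /eqP E' /eqP -> /eqP ->; subst a1 q1.
    exact: trans_cat H1 H2.
  + case/and5P=> /eqP E /eqP E' /eqP -> /eqP -> /eqP ->; subst p2 a2.
    exact: trans_fold H1 H2.
  + case/and5P=> /eqP E /eqP E' /eqP -> /eqP ->; subst q1 p2.
    case: a1 H1 => [[?|?|r1]|] // H1; case: a2 H2 => [[x|?|?]|] // H2.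
    case: a => [[?|?|r]|] // bot.
    have := trans_cat (trans_sym H2) (trans_cat H1 H2); apply: trans_le.
    rewrite /= -[r1]/(proj1_sig (Pcell B r1)); move: (Pcell B r1) bot.
    move: (bdim B r1).-2 => [|k] // c; rewrite mem_seq1 => /eqP [-> ->].
    exact: bottom_le.
- move=> rf Hps.
  have [_ /= H1] := Hps _ (mem_head _ _).
  have [|_ /= H2] := Hps (p2, a2, q2); first by rewrite !inE eqxx orbT.
  have [|_ /= H3] := Hps (p3, a3, q3); first by rewrite !inE eqxx !orbT.
  case/and5P: rf {Hps} => /eqP E /eqP E' /eqP E'' /eqP -> /andP [/eqP ->]; subst q1 p2 p3.
  case: a1 H1 => [[?|?|r]|] // H1; case: a2 H2 => [[x|?|?]|] // H2.
  case: a3 H3 => [[z|?|?]|] // H3; case: a => [[y|?|?]|] // tri.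
  have := trans_cat (trans_sym H2) (trans_cat H1 H3); apply: trans_le.
  rewrite /= -[r]/(proj1_sig (Pcell B r)); move: (Pcell B r) tri.
  move: (bdim B r).-2 => [|k] // c; rewrite mem_seq1 => /eqP [-> -> ->].
  exact: triangle_le.
Qed.

Definition pspokes (r : P) : seq X := spokes (Pcell B r).

Lemma pspokesE k (l : bcell k.+2) : pspokes (proj1_sig l) = spokes l.
Proof. exact: (Pcell_elim (fun k c => spokes (c : bcell k.+2)) l). Qed.

Hypothesis init_spokes : forall p r q x, init (p, Some (Lp r), q) ->
  x \in pspokes r -> exists s, D p (Some (Lx x)) s.

Lemma derived_spokes p k (l : bcell k.+2) x : Dcell p l ->
  x \in spokes l -> exists s, D p (Some (Lx x)) s.
Proof.
rewrite -pspokesE; move: (proj1_sig l) x => r {l} x H.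
pose Q (f : fact) := forall r, f.1.2 = Some (Lp r) ->
  forall x, x \in pspokes r -> exists s, D f.1.1 (Some (Lx x)) s.
suff HQ : forall f, f \in derived -> Q f by apply: (HQ _ H r) => //.
move=> {H x r p k}; apply: derivable_ind => ps [[p a] q] rf Hps t /= E x xt; subst a.
case: ps rf Hps => [|[[p1 a1] q1] [|[[p2 a2] q2] [|[[p3 a3] q3] [|? ?]]]] //=.
- by move=> ini _; apply: init_spokes ini xt.
- move=> + /(_ _ (mem_head _ _)) [D1 Q1].
  case/or4P; [|by case/andP|by case/andP|].
    case/and3P=> /eqP -> /eqP Ea _.
    case: a1 D1 Q1 Ea => [[?|?|r1]|] // D1 Q1 [Er]; subst r1.
    have [s ps] := Q1 t (erefl _) x xt.
    by exists s; apply: derived_comp ps; apply: derived_eq_sym (derived_idem D1).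
  case/and4P=> /eqP -> _ _; case: a1 D1 Q1 => [[x'|x'|r1]|] // _ Q1 side.
  apply: (Q1 r1 (erefl _)) => /=.
  rewrite -[r1]/(proj1_sig (Pcell B r1)) pspokesE; move: (Pcell B r1) side.
  move: (bdim B r1).-2 => [|k] // c /mapP [i]; rewrite mem_iota add1n ltnS => ik Et.
  by move: xt; rewrite Et pspokesE; apply: spokes_face.
- move=> rf Hps.
  have [D1 /= Q1] := Hps _ (mem_head _ _).
  have [|D2 /= Q2] := Hps (p2, a2, q2); first by rewrite !inE eqxx orbT.
  case/or3P: rf {Hps}; last 1 first.
  + case/and5P=> /eqP E /eqP E' /eqP -> /eqP _; subst q1 p2.
    case: a1 D1 Q1 => [[?|?|r1]|] // D1 Q1; case: a2 D2 Q2 => [[e|?|?]|] // D2 _ bot.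
    have [k [c Ec]] : exists k (c : bcell k.+2), r1 = proj1_sig c by exists _, (Pcell B r1).
    subst r1; have {}Q1 := Q1 _ (erefl _); rewrite pspokesE in Q1.
    move: bot; rewrite (Pcell_elim (@bottoms X P B) c).
    case: k c D1 Q1 => [|k] // c D1 Q1.
    rewrite mem_seq1 => /eqP [Ee Et]; subst e t; rewrite pspokesE in xt.
    (* The root moves from v_0 to v_1. Each missing edge [v_1,v_i] follows from the triangle rule at
       the old root [p1], where [v_0,v_i] is a spoke. *)
    pose Q' k (c : bcell k.+2) := Dcell p1 c /\
      forall x, x \in spokes c -> exists s, D p1 (Some (Lx x)) s.
    have [||l [[Dl Ql] lx le]] := @spokes_bottom _ _ B Q' _ _ c x _ xt.
    * clear c D1 D2 Q1 xt x k => k i c ik [Dc Qc]; split; first exact: derived_side.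
      by move=> x /(spokes_face ik) /Qc.
    * by split.
    have [s ps] := Ql (bfc 1 l) (@spokes_face _ _ B 0 1 l _ isT (mem_head _ _)).
    by exists s; have := derived_triangle Dl _ ps; rewrite lx le; apply.
  + case/and5P=> /eqP -> /eqP E1 /eqP E2 /eqP E3 /eqP _; subst a1 q1 a2.
    have [s ps] := Q2 t (erefl _) x xt.
    by exists s; apply: derived_comp ps.
  + by rewrite !andbF.
- move=> + _; case/and5P=> _ _ _ _ /andP [_].
  by case: a1 => [[]|] // ?; case: a2 => [[]|] // ?; case: a3 => [[]|].
Qed.

(** * Quotient by the derived identifications *)

Definition canon p : V := odflt p [pick q | D p None q].

Lemma canonP p : D p None p -> D p None (canon p).
Proof. by rewrite /canon; case: pickP => //= _ ->. Qed.

(** [pick] depends only on the extension of its predicate, and identified vertices have the same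
    class. *)
Lemma canon_eq p q : D p None q -> canon p = canon q.
Proof.
move=> pq; have qp := derived_eq_sym pq; rewrite /canon.
rewrite (eq_pick (Q := [pred r | D q None r])); last first.
  by move=> r /=; apply/idP/idP; apply: derived_comp.
by case: pickP => // /(_ p); rewrite /= qp.
Qed.

Lemma canonK p : D p None p -> canon (canon p) = canon p.
Proof. by move/canonP/canon_eq. Qed.

Lemma canon_valid p : D p None p -> D (canon p) None (canon p).
Proof. by move/canonP/derived_eq_sym/derived_refl. Qed.

Definition tgt p (x : X) : V :=
  if [pick q | D p (Some (Lx x)) q] is Some q then canon q else p.

Lemma derived_target p a q : D p a q -> D q None q.
Proof. by move/derived_sym/derived_refl. Qed.

Lemma tgtE p x q : D p (Some (Lx x)) q -> tgt p x = canon q.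
Proof.
rewrite /tgt; case: pickP => [q' pq' pq|-> //].
exact/canon_eq/(derived_fold pq').
Qed.

Lemma tgtP p x q : D p (Some (Lx x)) q -> D p (Some (Lx x)) (tgt p x).
Proof.
move=> pq; rewrite (tgtE pq); apply: derived_compr (pq) _.
exact/canonP/(derived_target pq).
Qed.

(** The equation [canon p == p] keeps one root per class. It also holds, by the default value of
    [canon], at vertices outside all facts, which the second conjunct excludes. *)
Definition valid k p : bcell k -> bool :=
  match k as k0 return bcell k0 -> bool with
  | 0 => fun _ => (canon p == p) && (D p None p)
  | 1 => fun x => (canon p == p) && [exists q, D p (Some (Lx x)) q]
  | k'.+2 => fun l => (canon p == p) && Dcell p l
  end.

Lemma valid_spoke p k (l : bcell k.+1) x : valid p l -> x \in spokes l ->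
  @valid 1 p x.
Proof.
case: k l => [|k] l; first by rewrite mem_seq1 => ? /eqP ->.
case/andP=> cp Dl xl; rewrite /= cp; apply/existsP.
exact: derived_spokes Dl xl.
Qed.

Lemma valid_edge p k (l : bcell k.+1) : valid p l -> D p (Some (Lx (bedge l))) (tgt p (bedge l)).
Proof.
move=> vl; have /andP [_ /existsP [q]] := valid_spoke vl (edge_spoke l).
exact: tgtP.
Qed.

Lemma canon_tgt p x : @valid 1 p x -> canon (tgt p x) = tgt p x.
Proof.
by case/andP=> _ /existsP [q pq]; rewrite (tgtE pq) canonK // (derived_target pq).
Qed.

Lemma valid_side k i p (l : bcell k.+1) : 0 < i <= k.+1 -> valid p l -> valid p (bfc i l).
Proof.
case: k l => [|[|k]] l ik vl.
- by case/andP: (vl) => cp /existsP [q /derived_refl]; rewrite /= cp.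
- by apply: valid_spoke vl _; apply: (spokes_face ik); rewrite mem_seq1.
- by case/andP: vl => cp Dl; rewrite /= cp; apply: derived_side.
Qed.

Lemma valid_bottom k p (l : bcell k.+1) : valid p l -> valid (tgt p (bedge l)) (bfc 0 l).
Proof.
move=> vl; have pe := valid_edge vl.
have ce : canon (tgt p (bedge l)) == tgt p (bedge l).
  by apply/eqP/canon_tgt; apply: valid_spoke vl (edge_spoke l).
case: k l vl pe ce => [|[|k]] l vl pe ce; rewrite /= ce.
- exact: derived_target pe.
- apply/existsP; case/andP: (vl) => _ Dl.
  have := valid_spoke vl (@spokes_face _ _ B 0 1 l _ isT (mem_head _ _)).
  case/andP=> _ /existsP [q pq]; exists q.
  exact: derived_triangle Dl pe pq.
- by case/andP: vl => _ Dl; apply: derived_bottom pe.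
Qed.

Lemma tgt_triangle k p (l : bcell k.+2) :
  valid p l -> tgt (tgt p (bedge l)) (bedge (bfc 0 l)) = tgt p (bedge (bfc 1 l)).
Proof.
have ss := @bface_ss _ _ B.
elim: k l => [|k IH] l vl.
  have := valid_spoke vl (@spokes_face _ _ B 0 1 l _ isT (mem_head _ _)).
  case/andP=> _ /existsP [q pq]; rewrite [RHS](tgtE pq); apply: tgtE.
  case/andP: (vl) => _ Dl; apply: derived_triangle Dl _ pq.
  exact: (valid_edge vl).
(* The last face still contains v_0, v_1 and v_2, the only vertices involved. *)
have vl' : valid p (bfc k.+3 l) by apply: valid_side vl; rewrite leqnn.
have := IH _ vl'; rewrite -[X in tgt p X]/(bedge l).
by rewrite (ss k.+1 0 k.+3) // (ss k.+1 1 k.+3) //= .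
Qed.

Lemma tgt_inj p q x : @valid 1 p x -> @valid 1 q x -> tgt p x = tgt q x -> p = q.
Proof.
case/andP=> /eqP cp /existsP [p' pp'] /andP [/eqP cq /existsP [q' qq']] E.
rewrite -cp -cq; apply: canon_eq.
have := derived_sym (tgtP qq'); rewrite -E.
exact: (derived_fold (derived_sym (tgtP pp'))).
Qed.

Variable o : V.

Inductive reached : V -> Prop :=
| reached_base : reached o
| reached_step p a q : reached p -> D p a q -> reached q.

(** Endpoints of a conclusion are always endpoints of its premises. *)
Lemma derived_reached : (forall p a q, init (p, a, q) -> reached p) ->
  forall p a q, D p a q -> reached p.
Proof.
move=> Hinit p a q H.
suff HQ : forall f, f \in derived -> reached f.1.1 /\ reached f.2 by case: (HQ _ H).
move=> {H p a q}; apply: derivable_ind => ps [[p a] q] /=.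
case: ps => [|[[p1 a1] q1] [|[[p2 a2] q2] [|[[p3 a3] q3] [|? ?]]]] //=.
- move=> ini _; have rp := Hinit _ _ _ ini; split=> //.
  exact: reached_step rp (derived_init ini).
- move=> rf /(_ _ (mem_head _ _)) [_ /= [r1 r1']].
  by case/or4P: rf => [/and3P[]|/and3P[]|/and4P[]|/and4P[]] /eqP -> // => [_|_|_|] /eqP ->.
- move=> rf Hps.
  have [_ /= [r1 r1']] := Hps _ (mem_head _ _).
  have [|_ /= [r2 r2']] := Hps (p2, a2, q2); first by rewrite !inE eqxx orbT.
  case/or3P: rf; first by case/and5P=> /eqP -> _ _ _ /eqP ->.
    by case/and5P=> _ _ /eqP -> _ /eqP ->.
  by case/and5P=> _ _ /eqP -> /eqP ->.
- move=> rf Hps.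
  have [|_ /= [r2 r2']] := Hps (p2, a2, q2); first by rewrite !inE eqxx orbT.
  have [|_ /= [r3 r3']] := Hps (p3, a3, q3); first by rewrite !inE eqxx !orbT.
  by case/and5P: rf => _ _ _ /eqP -> /andP [/eqP ->].
Qed.

(** * Finite numbering of the cells *)

Definition lcode k : bcell k -> option (X + P) :=
  match k as k0 return bcell k0 -> option (X + P) with
  | 0 => fun _ => None
  | 1 => fun x => Some (inl x)
  | k'.+2 => fun l => Some (inr (proj1_sig l))
  end.

Definition ldecode k : option (X + P) -> option (bcell k) :=
  match k as k0 return option (X + P) -> option (bcell k0) with
  | 0 => fun c => if c is None then Some tt else None
  | 1 => fun c => if c is Some (inl x) then Some x else None
  | k'.+2 => fun c => if c is Some (inr r) then
                        match bdim B r =P k'.+2 with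
                        | ReflectT E => Some (exist _ r E)
                        | ReflectF _ => None
                        end
                      else None
  end.

Lemma lcodeK k : pcancel (@lcode k) (@ldecode k).
Proof.
case: k => [|[|k]] //=; first by case.
move=> l; case: eqP => [E|]; last by rewrite (proj2_sig l).
by congr Some; apply: cellB_inj.
Qed.

Lemma ldecodeK k c (l : bcell k) : ldecode k c = Some l -> c = lcode l.
Proof.
case: k l => [|[|k]] l; case: c => [[x|r]|] //=; first by case=> ->.
by case: eqP => // E [<-].
Qed.

Definition cellpred k : pred (V * option (X + P)) :=
  fun c => if ldecode k c.2 is Some l then valid c.1 l else false.

(** Since one finite type codes the labels of all dimensions, the cells of each dimension form a
    decidable finite set. They are numbered to obtain the ordinals that the theorem asks for. *)
Definition fcell k : Type := 'I_#|cellpred k|.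

Definition froot k (c : fcell k) : V := (enum_val c).1.

Definition fcell_label k (c : fcell k) :
  {l : bcell k | ldecode k (enum_val c).2 = Some l & valid (froot c) l}.
Proof.
have := enum_valP c; rewrite unfold_in /cellpred /froot.
by case: (ldecode k _) => // l vl; exists l.
Defined.

Definition flab k (c : fcell k) : bcell k := s2val (fcell_label c).

Lemma flab_valid k (c : fcell k) : valid (froot c) (flab c).
Proof. exact: (s2valP' (fcell_label c)). Qed.

Lemma fcell_inj k (c c' : fcell k) : froot c = froot c' -> flab c = flab c' -> c = c'.
Proof.
have := s2valP (fcell_label c); have := s2valP (fcell_label c').
rewrite -!/(flab _) /froot => /ldecodeK E' /ldecodeK E rr ll.
apply: enum_val_inj; move: E E' rr; rewrite ll.
by case: (enum_val c) (enum_val c') => [p x] [p' x'] /= -> -> ->.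
Qed.

Lemma valid_cellpred k p (l : bcell k) : valid p l -> (p, lcode l) \in cellpred k.
Proof. by move=> vl; rewrite unfold_in /cellpred lcodeK. Qed.

Definition fmk k p (l : bcell k) (vl : valid p l) : fcell k :=
  enum_rank_in (valid_cellpred vl) (p, lcode l).

Lemma enum_val_fmk k p (l : bcell k) (vl : valid p l) : enum_val (fmk vl) = (p, lcode l).
Proof. exact/enum_rankK_in/valid_cellpred. Qed.

Lemma froot_fmk k p (l : bcell k) (vl : valid p l) : froot (fmk vl) = p.
Proof. by rewrite /froot enum_val_fmk. Qed.

Lemma flab_fmk k p (l : bcell k) (vl : valid p l) : flab (fmk vl) = l.
Proof.
have := s2valP (fcell_label (fmk vl)); rewrite -/(flab _) enum_val_fmk lcodeK.
by case.
Qed.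

Definition folded_complex : LC B fcell :=
  rooted_complex valid_side valid_bottom tgt_triangle tgt_inj froot_fmk flab_fmk
    flab_valid fcell_inj.

Lemma froot_canon k (c : fcell k) : canon (froot c) = froot c.
Proof.
by have := flab_valid c; case: k c => [|[|k]] c /andP [/eqP].
Qed.

Lemma froot_refl (v : fcell 0) : D (froot v) None (froot v).
Proof. by have /andP [] := flab_valid v. Qed.

Lemma froot_inj (v w : fcell 0) : froot v = froot w -> v = w.
Proof. exact: (root_inj0 fcell_inj). Qed.

Lemma valid_vertex p : D p None p -> @valid 0 (canon p) tt.
Proof. by move=> pp; rewrite /= canonK // eqxx canon_valid. Qed.

Lemma vertex_of p : D p None p -> exists v : fcell 0, froot v = canon p.
Proof.
by move=> pp; exists (fmk (valid_vertex pp)); rewrite froot_fmk.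
Qed.

Lemma step_derived v a w : step folded_complex v a w -> D (froot v) (Some a) (froot w).
Proof.
have HLx x v' w' : step folded_complex v' (Lx x) w' -> D (froot v') (Some (Lx x)) (froot w').
  by move=> /step_rooted_Lx [vx <-]; apply: (@valid_edge _ 0).
case: a => [x|x|r]; first exact: HLx.
  by move=> /step_sym /HLx /derived_sym.
by move=> /step_rooted_Lp [<- [k [l [<- /andP []]]]].
Qed.

Lemma derived_step p a q v w : D p (Some a) q -> froot v = canon p -> froot w = canon q ->
  step folded_complex v a w.
Proof.
have HLx x p' q' v' w' : D p' (Some (Lx x)) q' -> froot v' = canon p' -> froot w' = canon q' ->
    step folded_complex v' (Lx x) w'.
  move=> pq vp wq; apply/step_rooted_Lx; rewrite vp.
  have pc := canonP (derived_refl pq).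
  have cq : D (canon p') (Some (Lx x)) q' by apply: derived_comp pq; apply: derived_eq_sym.
  rewrite (tgtE cq) wq; split=> //.
  by rewrite /= canonK ?(derived_refl pq) // eqxx; apply/existsP; exists q'.
case: a => [x|x|r] pq vp wq; first exact: (HLx x p q).
  by apply/step_sym; apply: (HLx x q p) => //; apply: (derived_sym pq).
have pq0 := derived_idem pq.
apply/step_rooted_Lp; split; first by apply: froot_inj; rewrite vp wq (canon_eq pq0).
exists _, (Pcell B r); split=> //.
have cp := canonP (derived_refl pq).
rewrite vp /= canonK ?(derived_refl pq) // eqxx /=.
by apply: (derived_move cp cp); apply: derived_compr pq (derived_eq_sym pq0).
Qed.

Lemma act_trans gens (tau : V -> word X P) :
  (forall f, f \in derived -> trans B gens (tau f.1.1) (optw f.1.2) (tau f.2)) ->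
  forall v w v', act folded_complex v w v' -> trans B gens (tau (froot v)) w (tau (froot v')).
Proof.
move=> sound v w v'; elim=> {v w v'} [v|v a u w v' s _ IH].
  exact: (sound _ (froot_refl v)).
exact: trans_cat (sound _ (step_derived s)) IH.
Qed.

Lemma folded_connected (v0 : fcell 0) : D o None o -> froot v0 = canon o ->
  (forall p a q, init (p, a, q) -> reached p) -> connected folded_complex.
Proof.
move=> oo vo Hinit.
suff H p : reached p -> forall v, froot v = canon p ->
    clos_refl_sym_trans _ (adj folded_complex) v0 v.
  have H' v : clos_refl_sym_trans _ (adj folded_complex) v0 v.
    apply: (H (froot v)); last by rewrite froot_canon.
    exact: derived_reached Hinit _ _ _ (froot_refl v).
  by move=> v w; apply: rst_trans (H' w); apply: rst_sym.
elim=> {p} [|p a q _ IH pq] v vq.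
  by rewrite (froot_inj (etrans vq (esym vo))); apply: rst_refl.
have [u up] := vertex_of (derived_refl pq).
apply: rst_trans (IH u up) _.
case: a pq => [a|] pq; last first.
  have -> : v = u by apply: froot_inj; rewrite vq up (canon_eq pq).
  exact: rst_refl.
have s := derived_step pq up vq; case: a s {pq} => [x|x|r] /=.
- by move=> [e [_ [eu ev]]]; apply: rst_step; exists e.
- by move=> [e [_ [eu ev]]]; apply/rst_sym/rst_step; exists e.
- by move=> [-> _]; apply: rst_refl.
Qed.

End Folding.
Lemma List_InP (T : eqType) (x : T) (s : seq T) : reflect (List.In x s) (x \in s).
Proof.
elim: s => [|y s IH]; first by constructor.
rewrite inE; apply: (iffP orP) => -[/eqP|/IH]; rewrite 1?eq_sym; [left|right|left|right]; by [].
Qed.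

(** * The complex of H *)

Section CosetComplex.
Variables (X P : finType) (B : Bdata X P) (gens : seq (word X P)).
Local Notation N := (\max_(g <- gens) size g).

(* The useful vertices are the prefixes of the generators, each followed by at most one spoke
   of a cell attached there; the remaining words never enter a derived fact. *)
Definition prevertex : finType := N.+1.-bseq (letter X P).
Local Notation V := prevertex.

Definition vtx (w : word X P) : V := insub_bseq N.+1 w.

Lemma vtxK w : size w <= N.+1 -> vtx w = w :> word X P.
Proof. by move=> sw; rewrite -[LHS]/(val (vtx w)) /vtx /insub_bseq insubdK. Qed.

Lemma val_vtx (p : V) : vtx p = p.
Proof. by apply: val_inj; rewrite /= vtxK //; apply: (valP p). Qed.

Lemma size_prefix_gen u g : g \in gens -> prefix u g -> size u <= N.
Proof. by move=> gi /size_prefix ug; apply: leq_trans ug (leq_bigmax_seq g gi isT). Qed.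

Lemma vtx_prefix u g : g \in gens -> prefix u g -> vtx u = u :> word X P.
Proof. by move=> gi ug; apply/vtxK/leqW/(size_prefix_gen gi ug). Qed.

(** The paths spelled by the generators, each closed up by identifying its end with the empty word.
    The empty word is listed as well, so that the base vertex exists even without generators. A
    letter of P met on a path brings the spokes of its cell. *)
Definition gen_init (f : fact X P V) : bool :=
  let: (p, a, q) := f in
  match a with
  | None => ((q : word X P) == [::]) && ((p : word X P) \in [::] :: gens)
  | Some b => ((q : word X P) == rcons p b) &&
      (has (prefix q) gens ||
       if b is Lx x
       then has (fun g => [exists r, prefix (rcons p (Lp r)) g && (x \in pspokes B r)]) gens
       else false)
  end.

Local Notation D p a q := ((p, a, q) \in derived B gen_init).

Lemma derived_prefix u a g : g \in gens -> prefix (rcons u a) g ->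
  D (vtx u) (Some a) (vtx (rcons u a)).
Proof.
move=> gi ug; apply: derived_init => /=.
have ug' := prefix_trans (prefix_rcons u a) ug.
rewrite (vtx_prefix gi ug) (vtx_prefix gi ug') eqxx /=.
by apply/orP; left; apply/hasP; exists g.
Qed.

Lemma derived_base : D (vtx [::]) None (vtx [::]).
Proof. by apply: derived_init; rewrite /= vtxK. Qed.

Lemma derived_gen g : g \in gens -> D (vtx g) None (vtx [::]).
Proof.
move=> gi; apply: derived_init.
by rewrite /= vtxK // (vtx_prefix gi (prefix_refl g)) /= inE gi orbT.
Qed.

Lemma gen_init_sound p a q : gen_init (p, a, q) -> trans B gens p (optw a) q.
Proof.
have inHg g : g \in gens -> inH B gens g by move/List_InP; apply: inH_gen.
have prefixT u b g : g \in gens -> prefix (rcons u b) g -> trans B gens u [:: b] (rcons u b).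
  move=> gi /prefixP [v gE]; rewrite -cats1; apply: (@trans_step _ _ _ _ _ _ [::]).
  by apply: (@trans_prefix _ _ _ _ _ v); rewrite cats1 -gE; apply: inHg.
case: a => [b|] /andP [/eqP ->] /=; last first.
  rewrite inE /trans cats0 => /orP [/eqP ->|]; [exact: inH_nil | exact: inHg].
case/orP=> [/hasP [g gi qg]|]; first exact: prefixT gi qg.
case: b => // x /hasP [g gi /existsP [r /andP [rg xr]]].
have := prefixT _ _ _ gi rg => H.
(* The spoke is sound because p rho rho p^-1 lies in H and rho <= x x^-1. *)
have := trans_cat H (trans_sym H); rewrite -cats1 /trans invw_cat /=.
apply: inH_le; apply: leM_cat (leM_refl _ _) _.
apply: (@leM_cat _ _ B [:: Lp r; Lp r] [:: Lx x; Lxi x]) (leM_refl _ _).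
apply: leM_trans (leM_eq (Mc_idem B r)) _.
exact: (spoke_le (c := Pcell B r)).
Qed.

Lemma gen_init_spokes p r q x : gen_init (p, Some (Lp r), q) -> x \in pspokes B r ->
  exists s, D p (Some (Lx x)) s.
Proof.
case/andP=> /eqP qE; rewrite orbF => /hasP [g gi qg] xr.
exists (vtx (rcons p (Lx x))); apply: derived_init => /=.
have sz := size_prefix_gen gi qg.
rewrite vtxK ?eqxx /=; last by move: sz; rewrite qE !size_rcons => /leqW.
apply/orP; right; apply/hasP; exists g => //; apply/existsP; exists r.
by rewrite -qE qg.
Qed.

Local Notation reach := (reached B gen_init (vtx [::])).

Lemma reached_prefix u g : g \in gens -> prefix u g -> reach (vtx u).
Proof.
move=> gi; elim/last_ind: u => [|u a IH] ug; first exact: reached_base.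
apply: reached_step (derived_prefix gi ug).
exact: IH (prefix_trans (prefix_rcons u a) ug).
Qed.

Lemma gen_init_reached p a q : gen_init (p, a, q) -> reach p.
Proof.
suff H : gen_init (p, a, q) -> reach (vtx p) by move=> /H; rewrite val_vtx.
case: a => [b|] /andP [/eqP qE].
  have HH c g : g \in gens -> prefix (rcons p c) g -> reach (vtx p).
    by move=> gi /(prefix_trans (prefix_rcons _ _)); apply: reached_prefix.
  case/orP=> [/hasP [g gi]|]; first by rewrite qE; apply: HH gi.
  case: b {qE} => // x /hasP [g gi /existsP [r /andP [rg _]]].
  exact: HH gi rg.
rewrite inE => /orP [/eqP ->|gi]; first exact: reached_base.
exact: reached_prefix gi (prefix_refl _).
Qed.

Definition coset_cells k : nat := #|cellpred B gen_init (V := V) k|.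

Definition coset_complex : LC B (fun k => 'I_(coset_cells k)) :=
  folded_complex gen_init_spokes.

Definition coset_base : 'I_(coset_cells 0) :=
  fmk (valid_vertex derived_base).

Lemma coset_connected : connected coset_complex.
Proof.
apply: (@folded_connected _ _ _ _ _ gen_init_spokes (vtx [::]) coset_base).
- exact: derived_base.
- exact: froot_fmk.
- exact: gen_init_reached.
Qed.

Lemma act_prefix u g (v : 'I_(coset_cells 0)) : g \in gens -> prefix u g ->
  froot v = canon B gen_init (vtx u) -> act coset_complex coset_base u v.
Proof.
move=> gi; elim/last_ind: u v => [|u a IH] v ug vu.
  have -> : coset_base = v by apply: froot_inj; rewrite vu; exact: froot_fmk.
  exact: act_nil.
have D1 := derived_prefix gi ug.
have [w wu] := vertex_of (derived_refl D1).
rewrite -cats1; apply/act_cat; exists w.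
  exact: IH w (prefix_trans (prefix_rcons u a) ug) wu.
apply/act1; exact: derived_step D1 wu vu.
Qed.

Lemma coset_loop w : loopw coset_complex coset_base w <-> inH B gens w.
Proof.
split=> [|Hw]; last first.
  apply: loopw_inH Hw => g /List_InP gi; apply: (act_prefix gi (prefix_refl g)).
  by rewrite (canon_eq (derived_gen gi)); exact: froot_fmk.
have sound := derived_sound gen_init_sound.
move/(act_trans sound); rewrite froot_fmk => H.
(* The base is rooted at the representative of the empty word, possibly another word; [H0] links the
   two. *)
have H0 := sound _ (canonP derived_base).
have := trans_cat H0 (trans_cat H (trans_sym H0)).
by rewrite /trans /= vtxK //= cats0 cats0.
Qed.

End CosetComplex.

(** * Decidability *)

Section Decision.
Variables (X P : finType) (B : Bdata X P).

Lemma finType_exists_decidable (T : finType) (Q : T -> Prop) :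
  (forall x, decidable (Q x)) -> decidable (exists x, Q x).
Proof.
move=> dQ; have [H|H] := boolP [exists x, dQ x : bool].
  by left; have /existsP [x] := H; case: (dQ x) => // Qx _; exists x.
right=> -[x Qx]; case/negP: H; apply/existsP; exists x; by case: (dQ x).
Qed.

Variables (n : nat -> nat) (C : LC B (fun k => 'I_(n k))).

Lemma step_decidable v a w : decidable (step C v a w).
Proof.
case: a => [x|x|r] /=.
- apply: finType_exists_decidable => e.
  by apply: (decP (b := [&& (lab C e : X) == x, lface C 0 1 e == v & lface C 0 0 e == w]));
    apply: (iffP and3P) => [[/eqP ? /eqP ? /eqP ?]|[-> [-> ->]]].
- apply: finType_exists_decidable => e.
  by apply: (decP (b := [&& (lab C e : X) == x, lface C 0 1 e == w & lface C 0 0 e == v]));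
    apply: (iffP and3P) => [[/eqP ? /eqP ? /eqP ?]|[-> [-> ->]]].
have [->|vw] := eqVneq v w; last by right=> -[E]; case/eqP: vw.
(* [step] quantifies over all dimensions; the letter fixes the only possible one, which leaves a
   finite search. *)
suff [H|H] : decidable (exists c : 'I_(n (bdim B r).-2.+2),
    lab C c = Pcell B r /\ vert (lface C) 0 c = w).
- by left; split=> //; have [c [lc vc]] := H; exists _, c; rewrite lc.
- by right=> H'; apply: H; exact: (@step_Lp _ _ _ _ C w r _ (Pcell B r) (erefl _) H').
apply: finType_exists_decidable => c.
apply: (decP (b := (proj1_sig (lab C c) == r) && (vert (lface C) 0 c == w))).
apply: (iffP andP) => [[/eqP lc /eqP]|[-> ->]] //.
by split=> //; apply: cellB_inj.
Qed.

Lemma act_decidable v u w : decidable (act C v u w).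
Proof.
elim: u v => [|a u IH] v.
  have [->|vw] := eqVneq v w; first by left; constructor.
  by right=> H; inversion H; subst; case/eqP: vw.
have [H|H] : decidable (exists s, step C v a s /\ act C s u w).
- apply: finType_exists_decidable => s.
  have [vs|vs] := step_decidable v a s; last by right=> -[].
  by have [sw|sw] := IH s; [left | right=> -[]].
- by left; have [s [vs sw]] := H; apply: act_cons vs sw.
right=> H'; apply: H; inversion H' as [|? ? s ? ? vs sw]; subst.
by exists s.
Qed.

End Decision.

(** * Reduction of the word problem to membership *)

Section WordProblem.
Variables (X P : finType) (B : Bdata X P).
Implicit Types u v w : word X P.

(** Up to congruence the idempotent u u^-1 generates only itself and 1, so its closed submonoid is
    everything above u u^-1. From u u^-1 <= v u^-1, multiplication by [u] gives u <= v u^-1 u <=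
    v. *)
Lemma leM_inH u v : leM B u v <-> inH B [:: u ++ invw u] (v ++ invw u).
Proof.
split=> [uv|/inHP [n Gn nv]].
  apply: inH_le (leM_cat uv (leM_refl B (invw u))) _.
  by apply: inH_gen; left.
have {Gn} un : leM B (u ++ invw u) n.
  have gg : leM B (u ++ invw u) ((u ++ invw u) ++ (u ++ invw u)).
    exact/leM_eq/Mc_sym/midem_range.
  elim: Gn => [|g w [<-|[]] _ IH|g w [<-|[]] _ IH]; first exact: leM_range.
    exact: leM_trans gg (leM_cat (leM_refl _ _) IH).
  by rewrite invw_cat invwK; apply: leM_trans gg (leM_cat (leM_refl _ _) IH).
have H : leM B ((u ++ invw u) ++ u) ((v ++ invw u) ++ u).
  by apply: leM_cat (leM_refl _ _); apply: leM_trans nv.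
apply: leM_trans (leM_eq (Mc_sym (Mc_inv1 B u))) _; rewrite catA.
apply: leM_trans H _; rewrite -catA.
by have := leM_cat (leM_refl B v) (leM_domain B u); rewrite cats0.
Qed.

Lemma leM_decidable u v : decidable (leM B u v).
Proof.
have [H|H] := act_decidable (coset_complex B [:: u ++ invw u]) (coset_base B [:: u ++ invw u])
  (v ++ invw u) (coset_base B [:: u ++ invw u]).
  by left; apply/leM_inH/coset_loop.
by right=> /leM_inH /coset_loop.
Qed.

Lemma Mcong_decidable u v : decidable (Mcong B u v).
Proof.
have [uv|uv] := leM_decidable u v; last by right=> H; apply: uv; apply: leM_eq.
have [vu|vu] := leM_decidable v u; last by right=> H; apply: vu; apply/leM_eq/Mc_sym.
by left; apply: leM_anti.
Qed.

End WordProblem.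

Lemma ordinal_complex_finite (n : nat -> nat) : finite_complex (fun k => 'I_(n k)).
Proof. by move=> k; exists (enum 'I_(n k)) => c; apply/List_InP; rewrite mem_enum. Qed.

Theorem mainTheorem14 (X P : finType) (B : Bdata X P) :
  (* (a) the word problem for M(X,P) is decidable *)
  (forall u v : word X P, {Mcong B u v} + {~ Mcong B u v}) *
  (* (b) C_H is finite ... *)
  ((forall (gens : seq (word X P)) (cell : nat -> Type) (C : LC B cell) (v : cell 0),
      connected C -> (forall w, loopw C v w <-> inH B gens w) ->
      finite_complex cell) *
  (* ... and effectively constructible from a finite generating set *)
   (forall gens : seq (word X P),
      {n : nat -> nat & {C : LC B (fun k => 'I_(n k)) &
        {v : 'I_(n 0) | connected C /\ (forall w, loopw C v w <-> inH B gens w)}}})).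
Proof.
split; first exact: Mcong_decidable.
split=> [gens cell C v conn loops|gens].
  apply: (finite_complex_transfer (@coset_connected _ _ B gens) conn); last exact: ordinal_complex_finite.
  by move=> w; split=> [/coset_loop/loops|/loops/coset_loop].
exists (coset_cells B gens), (coset_complex B gens), (coset_base B gens).
split; [exact: coset_connected | exact: coset_loop].
Qed.
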